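(* Let $RF(s)=\frac{\prod_{l=1}^{m}(s-z_l)^{\gamma_l}}{\prod_{j=1}^{n}(s-p_j)^{\beta_j}}$ be a real rational function, let $K(s)$ be its gain function, and consider points $s=\sigma+it\in\Phi$. 1. If $cp\in\Omega_c$, then $cp\in\Omega_K$. 2. If $gp\in\Omega_K$, then $gp\in\Omega_c$. 3. $bp\in\Omega_b$ if and only if $bp\in\Omega_c$ and $bp\in\Omega_K$.
   Context: Here $\gamma_l,\beta_j$ are positive integers. The root locus equation of $RF$ is $K\cdot RF(s)=\pm1$, with gain function $K(s)=\pm\frac{\prod_{j=1}^{n}(s-p_j)^{\beta_j}}{\prod_{l=1}^{m}(s-z_l)^{\gamma_l}}$, the sign (in front of the fraction) being chosen so that $K\ge 0$ on the root locus considered: $+$ where the fraction is positive and $-$ where it is negative. $\Phi\subset\mathbb C\cup\{\infty\}$ is the set of points that are neither zeros nor poles of $RF$. The solutions of $K\cdot RF(s)=1$, $K\geq 0$ (points where $RF$ has argument $2q\pi$, $q\in\mathbb Z$) form curves called root loci of $2q\pi$ degree, and the solutions of $K\cdot RF(s)=-1$ (argument $2q\pi+\pi$) form root loci of $2q\pi+\pi$ degree; each single root locus is a branch going from its starting point (a pole of $RF$, or infinity) to its ending point (a zero of $RF$, or infinity). A breakaway point is a point where at least two root loci intersect. $\Omega_c$: the set of all real critical points of $RF$, excluding multiple zeros and multiple poles of $RF$. $\Omega_b$: the set of all real breakaway points of the root loci of $RF$, excluding multiple zeros and multiple poles of $RF$. $\Omega_K$: the set of all real critical points of $K(s)$, excluding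 multiple zeros and multiple poles of $RF$. *)

(* Defs.v *)
(* The complex plane is [R[i]] for [R : realType], used as
   [R[i]^o] where its topology or normed-module structure is needed. *)
From HB Require Import structures.
From mathcomp Require Export all_boot all_order all_algebra.
From mathcomp Require Export all_classical all_reals all_analysis.
From mathcomp Require Export complex.

Set Implicit Arguments.
Unset Strict Implicit.
Unset Printing Implicit Defensive.

Import Order.TTheory GRing.Theory Num.Theory.
Import numFieldNormedType.Exports.

Local Open Scope classical_set_scope.
Local Open Scope ring_scope.
Local Open Scope complex_scope.

Section Factored.
Context {R : realType} {k : nat} (a : 'I_k -> R[i]) (e : 'I_k -> nat).

Definition fpoly : {poly R[i]} := \prod_(i < k) ('X - (a i)%:P) ^+ e i.

Definition feval (s : R[i]) : R[i] := \prod_(i < k) (s - a i) ^+ e i.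

(* When [a] is injective, [e i] is the multiplicity of the root [a i]. *)
Definition multiple_root : set R[i] := [set s | exists2 i, s = a i & (1 < e i)%N].

End Factored.

Section CriticalPoint.
Context {R : realType}.

(* Complex differentiability is part of [is_derive]: at a pole [f] takes the
   value [0] (division by zero) but is not differentiable. *)
Definition critical_point (f : R[i]^o -> R[i]^o) (s : R[i]^o) : Prop :=
  is_derive s (1 : R[i]^o) f 0.

End CriticalPoint.

Section RootLocus.
Context {R : realType} {m n : nat}.
Context (z : 'I_m -> R[i]) (gamma : 'I_m -> nat).
Context (p : 'I_n -> R[i]) (beta : 'I_n -> nat).

Definition RF (s : R[i]^o) : R[i]^o := feval z gamma s / feval p beta s.

(* Finite points only: infinity is not real, so it is in none of the Omegas. *)
Definition Phi : set R[i] :=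
  [set s | (forall l, s <> z l) /\ (forall j, s <> p j)].

(* [b = false] is the sign [+], i.e. the loci of [2 q pi] degree;
   [b = true] is the sign [-], i.e. the loci of [2 q pi + pi] degree. *)
Definition gain (b : bool) (s : R[i]^o) : R[i]^o :=
  (-1) ^+ b * (feval p beta s / feval z gamma s).

(* In [R[i]], [0 <= x] means that [x] is real and nonnegative. *)
Definition root_locus_point (b : bool) (s : R[i]) : Prop :=
  (0 : R[i]) <= gain b s /\ gain b s * RF s = (-1) ^+ b.

Definition tends_to_infinity (c : R -> R[i]^o) (F : set_system R) : Prop :=
  complex.Re `|(c t : R[i])| @[t --> F] --> +oo.

(* A single root locus: a branch [c], parametrised by the open interval ]0, 1[
   in the direction of increasing gain, from a pole or infinity to a zero or
   infinity. The end points are limits, not values, of [c]. If [RF] is finite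
   and nonzero at infinity, a branch that reaches infinity ends there, and
   another one starts there. *)
Definition root_locus (b : bool) (c : R -> R[i]^o) : Prop :=
  [/\ forall t : R, t \in `]0, 1[ -> {for t, continuous c},
      forall t : R, t \in `]0, 1[ -> root_locus_point b (c t),
      forall t u : R, t \in `]0, 1[ -> u \in `]0, 1[ -> t < u ->
        (gain b (c t) : R[i]) < gain b (c u),
      (exists j, c t @[t --> 0^'+] --> (p j : R[i]^o)) \/
        tends_to_infinity c 0^'+
    & (exists l, c t @[t --> 1^'-] --> (z l : R[i]^o)) \/
        tends_to_infinity c 1^'- ].

Definition trace (c : R -> R[i]^o) : set R[i]^o := c @` [set` `]0, 1[].

(* Two loci intersect at [s] if both pass through [s] and have no other common
   point near [s]. Merely asking for two different loci through [s] would be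
   wrong: past a breakaway point a branch can be continued in several ways, and
   two branches that differ only there share whole arcs of ordinary points. *)
Definition intersect_at (c1 c2 : R -> R[i]^o) (s : R[i]^o) : Prop :=
  [/\ trace c1 s, trace c2 s
    & \forall w \near s, trace c1 w -> trace c2 w -> w = s].

Definition breakaway_point (s : R[i]) : Prop :=
  exists b1 b2 c1 c2,
    [/\ root_locus b1 c1, root_locus b2 c2 & intersect_at c1 c2 s].

(* The gain function is the one of a locus passing through [s], so its sign is
   fixed by [0 <= gain b s] at [s] and kept constant when differentiating. *)
Definition critical_point_of_gain (s : R[i]) : Prop :=
  exists b, (0 : R[i]) <= gain b s /\ critical_point (gain b) s.

Definition real_not_multiple (P : R[i] -> Prop) : set R[i] :=
  [set s | [/\ s \is Num.real, P s,
               ~ multiple_root z gamma s & ~ multiple_root p beta s]].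

Definition Omega_c : set R[i] := real_not_multiple (critical_point RF).
Definition Omega_b : set R[i] := real_not_multiple breakaway_point.
Definition Omega_K : set R[i] := real_not_multiple critical_point_of_gain.

End RootLocus.

(* Main.v *)
(* Points of gain [k = t / (1 - t)] are the roots of the pencil
   [(1 - t) D - (-1)^b t N], where [D] and [N] are the denominator and the
   numerator of [RF], and all the critical points are roots of the Wronskian
   [W = D N' - D' N].
   If [W s <> 0], then [RF] is injective near [s], so two loci through [s] with
   increasing gain meet again near [s], by the intermediate value theorem, and
   [s] is not a breakaway point.
   If [W s = 0], the roots of the pencil, seen on the projective line, can be
   followed by continuous functions [y_i] of [t] in [0, 1] (Kato): between the
   finitely many [t] where the pencil has a multiple root, simple roots continue
   uniquely, and at such a [t] each continuation converges because its limit
   points are among finitely many roots. Two of the [y_i] pass through [s], they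
   can only meet at roots of [W], and cutting them where they reach infinity
   yields two loci that meet only at [s] near [s]. *)
Require Import Defs.
From mathcomp Require Import perm ring lra.

Set Implicit Arguments.
Unset Strict Implicit.
Unset Printing Implicit Defensive.

Import Order.TTheory GRing.Theory Num.Theory.
Import numFieldNormedType.Exports.
Local Open Scope classical_set_scope.
Local Open Scope ring_scope.
Local Open Scope complex_scope.

(** * Connectedness of intervals *)

(** Supremum argument in a form suited to gluing: [P] holds across a window around the supremum of
    the points [t] with [P a t], so by transitivity it passes beyond that supremum unless [b] is
    reached. *)
Lemma interval_chain (R : realType) (P : R -> R -> Prop) (a b : R) :
    a <= b ->
    (forall x y z, P x y -> P y z -> P x z) ->
    (forall t, a <= t <= b -> \forall e \near (0 : R)^'+,
      forall u v, a <= u -> u <= t -> t <= v -> v <= b ->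
        t - e < u -> v < t + e -> P u v) ->
  P a b.
Proof.
move=> ab Ptrans Ploc.
have {}Ploc t : a <= t <= b -> exists2 e, 0 < e & forall u v,
    a <= u -> u <= t -> t <= v -> v <= b -> t - e < u -> v < t + e -> P u v.
  move=> /Ploc H; near (0 : R)^'+ => e; exists e => //.
  exact: (near H e).
pose A := [set t : R | a <= t <= b /\ P a t].
have Aa : A a.
  split; first by rewrite lexx ab.
  have [|e e0 H] := Ploc a; first by rewrite lexx ab.
  by apply: H => //; rewrite ?ltrDl ?ltrBlDr ?ltrDl.
have supA : has_sup A.
  by split; [exists a | exists b => t [/andP[]]].
have aS : a <= sup A by apply: ub_le_sup => //; case: supA.
have Sb : sup A <= b by apply: ge_sup; [exists a | move=> t [/andP[]]].
have [|e e0 H] := Ploc (sup A); first by rewrite aS Sb.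
have [t [/andP[at_ tb] Pat] tS] := sup_adherent e0 supA.
have tleS : t <= sup A by apply: ub_le_sup; [case: supA | split=> //; rewrite at_].
(* A point past the supremum unless [b] comes first; since it lies in [A], it can only be [b]. *)
pose s := Num.min b (sup A + e / 2).
have sS : sup A <= s by rewrite /s le_min Sb lerDl divr_ge0// ltW.
have Ps : P a s.
  apply: Ptrans Pat _; apply: H => //; first by rewrite /s ge_min lexx.
  by rewrite gt_min ltrD2l ltr_pdivrMr// ltr_pMr// ltr1n orbT.
have /(ub_le_sup supA.2) : A s.
  by split=> //; rewrite (le_trans aS sS) /s ge_min lexx.
move: Ps; rewrite /s => Ps1; rewrite ge_min => /orP[bS|].
  by move: Ps1; rewrite min_l// (le_trans bS)// lerDl divr_ge0// ltW.
by rewrite gerDl leNgt divr_gt0.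
Unshelve. all: by end_near. Qed.

Lemma locally_constant_itv (R : realType) (A : R -> Prop) (a b : R) :
    a <= b ->
    (forall t, a <= t <= b ->
      \forall x \near t, a <= x <= b -> (A x <-> A t)) ->
  A a <-> A b.
Proof.
move=> ab Aloc.
apply: (@interval_chain R (fun x y => A x <-> A y)) => //.
  by move=> x y z -> .
move=> t tab; move/nbhs_ballP: (Aloc t tab) => [d d0 Hd].
near=> e => u v au ut tv vb eu ve.
have de : e <= d by near: e; exact: nbhs_right_le.
have := Hd u; have := Hd v.
rewrite /ball /= !ltr_distlC => Hv Hu.
have {}Hu : A u <-> A t.
  apply: Hu; last by rewrite au (le_trans ut)// (le_trans tv).
  apply/andP; split; first by rewrite (le_lt_trans _ eu)// lerB.
  by rewrite (le_lt_trans ut)// ltrDl.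
have {}Hv : A v <-> A t.
  apply: Hv; last by rewrite vb (le_trans au)// (le_trans ut).
  apply/andP; split; first by rewrite (lt_le_trans _ tv)// ltrBlDr ltrDl.
  by rewrite (lt_le_trans ve)// lerD2l.
by rewrite Hu Hv.
Unshelve. all: by end_near. Qed.

(** * Auxiliary facts on polynomials and limits *)

Lemma deriv_prod_double_root (F : fieldType) (I : finType)
    (q : I -> {poly F}) (i j : I) (x : F) :
  i != j -> (q i).[x] = 0 -> (q j).[x] = 0 -> ((\prod_k q k)^`()).[x] = 0.
Proof.
move=> ij qi qj; rewrite (bigD1 i)//= derivM hornerD !hornerM qi mul0r addr0.
rewrite (bigD1 j) ?hornerM ?qj ?mul0r ?mulr0//.
by rewrite eq_sym.
Qed.

(** Induction on [r], dividing by ['X - x%:P]: the constant remainder is absorbed by the product,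
    whose factors are all at least [e]. The bound [M] is independent of [y], which later makes
    estimates uniform over all roots. *)
Lemma horner_le_prod_dist (K : numFieldType) (r : seq K) (P : {poly K}) (e : K) :
    (size P <= (size r).+1)%N -> 0 < e ->
  exists2 M, 0 <= M & forall y, (forall x, x \in r -> e <= `|y - x|) ->
    `|P.[y]| <= M * \prod_(x <- r) `|y - x|.
Proof.
move=> + e0; elim: r P => [|x r IH] P /= sP.
  exists `|P`_0| => // y _; rewrite big_nil mulr1.
  by rewrite (size1_polyC sP) hornerC coefC.
have /factor_theorem[q Dq] : root (P - P.[x]%:P) x by rewrite /root !hornerE subrr.
have sq : (size q <= (size r).+1)%N.
  have [->|q0] := eqVneq q 0; first by rewrite size_poly0.
  have : (size (q * ('X - x%:P))%R <= (size r).+2)%N.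
    rewrite -Dq (leq_trans (size_polyD _ _))// geq_max sP size_polyN.
    by rewrite (leq_trans (size_polyC_leq1 _)).
  by rewrite size_Mmonic ?monicXsubC// size_XsubC addn2.
have [M M0 HM] := IH q sq.
exists (M + `|P.[x]| / e ^+ (size r).+1) => [|y Hy].
  by rewrite addr_ge0// divr_ge0// exprn_ge0// ltW.
have -> : P.[y] = q.[y] * (y - x) + P.[x].
  have := congr1 (fun p => p.[y]) Dq; rewrite !hornerE => /eqP.
  by rewrite subr_eq => /eqP.
rewrite big_cons mulrDl (le_trans (ler_normD _ _))// lerD//.
  rewrite normrM mulrC [leRHS]mulrCA ler_wpM2l// HM// => z zr.
  by rewrite Hy// inE zr orbT.
rewrite -mulrA ler_peMr// ler_pdivlMl ?exprn_gt0// mulr1 exprS.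
rewrite ler_pM ?exprn_ge0 ?(ltW e0) ?Hy ?inE ?eqxx//.
have {}Hy z : z \in r -> e <= `|y - z| by move=> zr; rewrite Hy// inE zr orbT.
elim: r Hy {IH sP sq HM} => [|z r IH] Hy; first by rewrite big_nil.
rewrite big_cons /= exprS ler_pM ?exprn_ge0 ?(ltW e0) ?Hy ?inE ?eqxx//.
by apply: IH => z' z'r; rewrite Hy// inE z'r orbT.
Qed.
(** Stands in for a minimum: the order of [K] is partial, but positive elements are real and hence
    comparable. *)
Lemma positive_lower_bound (K : numFieldType) (a b : K) : 0 < a -> 0 < b ->
  exists c, [/\ 0 < c, c <= a & c <= b].
Proof.
move=> a0 b0; have /orP[ab|ba] := real_leVge (gtr0_real a0) (gtr0_real b0).
  by exists a.
by exists b.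
Qed.

(** The inverse of one plus all inverse distances lies below every nonzero distance; coinciding
    pairs contribute 0 to the sum because the inverse of 0 is 0. *)
Lemma values_separated (K : numFieldType) (I : finType) (x : I -> K) :
  exists2 e, 0 < e & forall i j, `|x i - x j| < e -> x i = x j.
Proof.
pose S := \sum_i \sum_j `|x i - x j|^-1.
have S0 : 0 <= S.
  by rewrite /S; apply: sumr_ge0 => ? _; apply: sumr_ge0 => ? _; rewrite invr_ge0.
have S1 : 0 < 1 + S by rewrite ltr_pwDl.
exists (1 + S)^-1; first by rewrite invr_gt0.
move=> i j H; apply/eqP; rewrite -subr_eq0; apply/negPn/negP => xij.
have n0 : 0 < `|x i - x j| by rewrite normr_gt0.
move: H; rewrite -[ltLHS]invrK ltf_pV2 ?posrE ?invr_gt0// => H.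
suff : `|x i - x j|^-1 <= S by move=> /(lt_le_trans H); rewrite gtrDr ltr10.
rewrite /S (bigD1 i)//= (bigD1 j)//= -addrA lerDl addr_ge0//.
  by apply: sumr_ge0 => ? _; rewrite invr_ge0.
by apply: sumr_ge0 => ? _; apply: sumr_ge0 => ? _; rewrite invr_ge0.
Qed.

(** In characteristic 0 the natural numbers would give a nonzero difference too many roots. *)
Lemma poly_ext (K : numFieldType) (p q : {poly K}) :
  (forall x, p.[x] = q.[x]) -> p = q.
Proof.
move=> pq; apply/eqP; rewrite -subr_eq0; apply/negPn/negP => pq0.
have := @max_poly_roots _ (p - q) [seq k%:R | k <- iota 0 (size (p - q))] pq0.
rewrite size_map size_iota ltnn => H; suff: false by []; apply: H.
  by apply/allP => x _; rewrite /root hornerD hornerN pq subrr.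
by rewrite map_inj_uniq ?iota_uniq// => m n /eqP; rewrite eqr_nat => /eqP.
Qed.

Lemma cvg_prod_family (K : numFieldType) (T I : Type) (F : set_system T)
    (FF : Filter F) (r : seq I) (f : I -> T -> K^o) (l : I -> K^o) :
  (forall i, f i t @[t --> F] --> l i) ->
  (\prod_(i <- r) f i t : K^o) @[t --> F] --> (\prod_(i <- r) l i : K^o).
Proof.
move=> fl; elim: r => [|i r IH].
  by under eq_fun do rewrite big_nil; rewrite big_nil; exact: cvg_cst.
under eq_fun do rewrite big_cons; rewrite big_cons.
by apply: cvgM.
Qed.

Lemma continuous_near_eq (T U : topologicalType) (f g : T -> U) (x : T) :
  (\forall y \near x, f y = g y) -> {for x, continuous g} -> {for x, continuous f}.
Proof.
move=> fg gx; have fgx := nbhs_singleton fg.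
apply: (@cvg_trans _ (g y @[y --> x])); last by rewrite /= fgx; exact: gx.
by apply: near_eq_cvg; apply: filterS fg.
Qed.

Lemma continuous_near_dist (K : numFieldType) (T : topologicalType)
    (V : normedModType K) (f : T -> V) x e : {for x, continuous f} -> 0 < e ->
  \forall y \near x, `|f x - f y| < e.
Proof. by move=> /cvgrPdist_lt fx e0; exact: fx. Qed.

(** * Continuous selection of the roots of a pencil *)

Section Pencil.
Context {R : realType} {K : numClosedFieldType} (iota : {rmorphism R -> K}).
Hypothesis iota_continuous : continuous (iota : R -> K^o).
Implicit Types (p P Q : {poly K}) (a b t : R).

Definition pencil P Q t : {poly K} := P + iota t *: Q.

(** The coefficient of degree [d] never vanishes, so no root escapes to infinity as [t] varies. *)
Definition regular_pencil (d : nat) P Q : Prop :=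
  [/\ (size P <= d.+1)%N, (size Q <= d.+1)%N & forall t, (pencil P Q t)`_d != 0].

(** Roots with multiplicity are indexed by ['I_d], so that each index can be followed when the
    polynomial varies. *)
Definition splits (d : nat) (p : {poly K}) (y : 'I_d -> K) : Prop :=
  p = p`_d *: \prod_(i < d) ('X - (y i)%:P).

Definition simple_roots (p : {poly K}) : Prop :=
  forall x, root p x -> ~~ root p^`() x.

Lemma eq_splits d p (y y' : 'I_d -> K) :
  (forall i, y i = y' i) -> splits p y -> splits p y'.
Proof. by move=> yy'; rewrite (_ : y = y')//; exact/funext. Qed.

Lemma pencil_horner P Q t (x : K) : (pencil P Q t).[x] = P.[x] + iota t * Q.[x].
Proof. by rewrite hornerD hornerZ. Qed.

Lemma regular_pencil_opp d P Q : regular_pencil d P Q -> regular_pencil d P (- Q).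
Proof.
move=> [sP sQ PQ]; split=> //; first by rewrite size_polyN.
by move=> t; have := PQ (- t); rewrite /pencil raddfN /= scaleNr scalerN.
Qed.

Lemma regular_pencil_size d P Q t : regular_pencil d P Q ->
  size (pencil P Q t) = d.+1.
Proof.
move=> [sP sQ PQ]; apply/eqP; rewrite eqn_leq; apply/andP; split.
  rewrite (leq_trans (size_polyD _ _))// geq_max sP.
  by rewrite (leq_trans (size_scale_leq _ _)).
by rewrite ltnNge; apply: contra (PQ t) => s; rewrite nth_default.
Qed.

Lemma splits_ex d p : size p = d.+1 -> exists y : 'I_d -> K, splits p y.
Proof.
move=> sp; have [r Dr] := closed_field_poly_normal p.
have p0 : lead_coef p != 0 by rewrite lead_coef_eq0 -size_poly_eq0 sp.
have sr : size r = d.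
  by move: sp; rewrite Dr size_scale// size_prod_XsubC => -[].
exists (fun i => r`_i); rewrite /splits.
have -> : p`_d = lead_coef p by rewrite /lead_coef sp.
by rewrite {1}Dr (big_nth 0) sr big_mkord.
Qed.

Lemma splits_horner d p (y : 'I_d -> K) (x : K) : splits p y ->
  p.[x] = p`_d * \prod_(i < d) (x - y i).
Proof.
move=> yp; rewrite {1}yp hornerZ horner_prod; congr (_ * _).
by apply: eq_bigr => i _; rewrite hornerXsubC.
Qed.

Lemma splits_root d p (y : 'I_d -> K) i : splits p y -> root p (y i).
Proof.
by move=> /splits_horner E; rewrite /root E (bigD1 i)//= subrr mul0r mulr0.
Qed.

Lemma root_splits d p (y : 'I_d -> K) (x : K) : splits p y -> p`_d != 0 ->
  root p x -> exists i, x = y i.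
Proof.
move=> /splits_horner E p0; rewrite /root E mulf_eq0 (negPf p0) /=.
by move=> /prodf_eq0[i _]; rewrite subr_eq0 => /eqP; exists i.
Qed.

Lemma splits_perm d p (y y' : 'I_d -> K) : p`_d != 0 ->
    splits p y -> splits p y' ->
  exists s : {perm 'I_d}, forall i, y' i = y (s i).
Proof.
move=> p0 yp y'p.
have : \prod_(i < d) ('X - (y' i)%:P) = \prod_(i < d) ('X - (y i)%:P).
  by apply: (scalerI p0); rewrite -yp -y'p.
pose tup (f : 'I_d -> K) := [tuple f i | i < d].
have E (f : 'I_d -> K) :
    \prod_(i < d) ('X - (f i)%:P) = \prod_(x <- tup f) ('X - x%:P).
  by rewrite big_tuple; apply: eq_bigr => i _; rewrite tnth_mktuple.
rewrite !E => /prod_XsubC_eq/tuple_permP[s Ds]; exists s => i.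
have /(congr1 (fun u => tnth u i)) := val_inj Ds.
by rewrite !tnth_mktuple.
Qed.

Lemma simple_roots_inj d p (y : 'I_d -> K) :
  splits p y -> simple_roots p -> injective y.
Proof.
move=> yp ps i j yij; apply/eqP/negPn/negP => ij.
have := ps _ (splits_root i yp); rewrite yp derivZ /root hornerZ.
rewrite (@deriv_prod_double_root _ _ _ i j) ?mulr0 ?eqxx// hornerXsubC ?subrr//.
by rewrite yij subrr.
Qed.

Lemma inj_splits d p (y : 'I_d -> K) : size p = d.+1 ->
  injective y -> (forall i, root p (y i)) -> splits p y.
Proof.
move=> sp yinj yr.
have E : \prod_(i < d) ('X - (y i)%:P) = \prod_(x <- [seq y i | i <- enum 'I_d]) ('X - x%:P).
  by rewrite big_map big_enum.
rewrite /splits E -[p`_d](_ : lead_coef p = _); last by rewrite /lead_coef sp.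
apply: all_roots_prod_XsubC.
- by rewrite size_map size_enum_ord sp.
- by apply/allP => _ /mapP[i _ ->].
- by rewrite uniq_rootsE map_inj_uniq ?enum_uniq.
Qed.

Lemma pencil_horner_continuous P Q (x : K) :
  continuous (fun t => (pencil P Q t).[x] : K^o).
Proof.
move=> t; under eq_fun do rewrite pencil_horner.
apply: cvgD; first exact: cvg_cst.
by apply: cvgM; [exact: iota_continuous | exact: cvg_cst].
Qed.

Lemma pencil_coef_continuous P Q k :
  continuous (fun t => (pencil P Q t)`_k : K^o).
Proof.
move=> t; under eq_fun do rewrite coefD coefZ.
apply: cvgD; first exact: cvg_cst.
by apply: cvgM; [exact: iota_continuous | exact: cvg_cst].
Qed.

(** * Dependence of the roots on the parameter *)

(** A root [y] at [t] satisfies [(pencil P Q t0).[y] = (iota t0 - iota t) * Q.[y]]. Away from the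
    roots at [t0], the left side is the leading coefficient times the product of the distances to
    these roots, while the right side is at most a small multiple of that product. *)
Lemma pencil_root_near d P Q t0 (x : 'I_d -> K) (e : K) :
    regular_pencil d P Q -> splits (pencil P Q t0) x -> 0 < e ->
  \forall t \near t0, forall y : K, root (pencil P Q t) y ->
    exists i, `|y - x i| < e.
Proof.
move=> PQ xs e0; have [_ sQ ld] := PQ.
have sQ' : (size Q <= (size [seq x i | i <- enum 'I_d]).+1)%N.
  by rewrite size_map size_enum_ord.
have [M M0 HM] := horner_le_prod_dist sQ' e0.
(* [M] may be zero, hence the divisor [M + 1]. *)
have : \forall t \near t0, `|iota t - iota t0 : K^o| * (M + 1) < `|(pencil P Q t0)`_d|.
  have M1 : 0 < M + 1 by rewrite ltr_wpDl.
  have Me : 0 < `|(pencil P Q t0)`_d| / (M + 1) by rewrite divr_gt0// normr_gt0.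
  apply: filterS (continuous_near_dist (@iota_continuous t0) Me) => t.
  by rewrite ltr_pdivlMr// distrC.
apply: filterS => t tM y yr; apply: contrapT => /forallNP H.
have {}H i : e <= `|y - x i|.
  by have /negP := H i; rewrite -real_leNgt// ?normr_real// gtr0_real.
have /HM : forall z, z \in [seq x i | i <- enum 'I_d] -> e <= `|y - z|.
  by move=> _ /mapP[i _ ->].
rewrite big_map big_enum /= => QM.
have /splits_horner E := xs.
have : (pencil P Q t0).[y] = (iota t0 - iota t) * Q.[y].
  move: yr; rewrite /root !pencil_horner => /eqP yr.
  rewrite -[LHS]subr0 -yr; ring.
rewrite E => /(congr1 Num.norm); rewrite !normrM => eqn.
have pr0 : 0 < \prod_i `|y - x i|.
  by apply: prodr_gt0 => i _; rewrite (lt_le_trans e0).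
suff : `|(pencil P Q t0)`_d| * \prod_i `|y - x i| < `|(pencil P Q t0)`_d| * \prod_i `|y - x i|.
  by rewrite ltxx.
rewrite normr_prod in eqn; rewrite [X in X < _]eqn.
rewrite (le_lt_trans (ler_wpM2l _ QM))// mulrA ltr_pM2r//.
rewrite (le_lt_trans _ tM)// distrC ler_wpM2l//.
by rewrite lerDl.
Qed.

(** The distances from [x] to the roots at [t] have product [(pencil P Q t).[x]] over the leading
    coefficient, in norm. It tends to 0, so the [d] distances cannot all be at least [e]. *)
Lemma pencil_near_root d P Q t0 (x e : K) :
    regular_pencil d P Q -> root (pencil P Q t0) x -> 0 < e ->
  \forall t \near t0, exists2 y : K, root (pencil P Q t) y & `|x - y| < e.
Proof.
move=> PQ xr e0; have [_ _ ld] := PQ.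
have : \forall t \near t0, `|(pencil P Q t).[x] / (pencil P Q t)`_d| < e ^+ d.
  have ed : 0 < e ^+ d by rewrite exprn_gt0.
  have h : {for t0, continuous
      (fun t => (pencil P Q t).[x] / (pencil P Q t)`_d : K^o)}.
    apply: cvgM; first exact: pencil_horner_continuous.
    by apply: cvgV => //; exact: pencil_coef_continuous.
  apply: filterS (continuous_near_dist h ed) => t.
  by rewrite (eqP xr) mul0r sub0r normrN.
apply: filterS => t te.
have [y ys] := splits_ex (regular_pencil_size t PQ).
apply: contrapT => H; move: te.
rewrite (splits_horner _ ys) mulrC mulKf// normr_prod.
suff : e ^+ d <= \prod_i `|x - y i| by move=> /le_lt_trans h /h; rewrite ltxx.
rewrite -[X in e ^+ X]card_ord -prodr_const ler_prod// => i _.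
rewrite (ltW e0) /= real_leNgt ?normr_real ?gtr0_real//.
by apply/negP => xy; apply: H; exists (y i) => //; exact: splits_root.
Unshelve. all: by end_near. Qed.

Lemma continuous_clamp (U : topologicalType) (f : R -> U) (u v : R) : u <= v ->
    (forall t, u <= t <= v -> {for t, continuous f}) ->
  continuous (fun t => f (Num.max u (Num.min t v))).
Proof.
move=> uv fc t.
apply: (@continuous_comp _ _ _ (fun t => Num.max u (Num.min t v)) f).
  apply: continuous_max; first exact: cvg_cst.
  by apply: continuous_min; [exact: cvg_id | exact: cvg_cst].
by apply: fc; rewrite le_max lexx/= ge_max uv/= ge_min lexx orbT.
Qed.

(** The roots at [t0] are centres of disjoint discs, and for [t] near [t0] each disc contains a
    root. There are [d] discs and [d] roots, so each disc contains exactly one, which defines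
    [Y i t]. *)
Lemma local_selection d P Q t0 :
    regular_pencil d P Q -> simple_roots (pencil P Q t0) ->
  exists Y : 'I_d -> R -> K^o, \forall t \near t0,
    [/\ forall i, {for t, continuous (Y i)},
        splits (pencil P Q t) (Y^~ t) & injective (Y^~ t)].
Proof.
move=> PQ simp.
have [x xs] := splits_ex (regular_pencil_size t0 PQ).
have xinj := simple_roots_inj xs simp.
have [e e0 He] := values_separated x.
have e20 : 0 < e / 2 by rewrite divr_gt0.
pose G t := forall i, exists2 y : K, root (pencil P Q t) y & `|x i - y| < e / 2.
have nG : \forall t \near t0, G t.
  have H i := pencil_near_root PQ (splits_root i xs) e20.
  exact: filter_forall (nbhs_filter t0) H.
pose Y i t : K^o :=
  xget (x i) [set y | root (pencil P Q t) y /\ `|x i - y| < e / 2].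
have GY t : G t -> forall i, root (pencil P Q t) (Y i t) /\ `|x i - Y i t| < e / 2.
  move=> Gt i; have [y yr xy] := Gt i.
  exact: (@xgetPex _ (x i) [set y | root (pencil P Q t) y /\ `|x i - y| < e / 2]
    (ex_intro _ y (conj yr xy))).
have close i j (y : K) : `|x i - y| < e / 2 -> `|x j - y| < e / 2 -> i = j.
  move=> iy jy; apply/xinj/He; rewrite (splitr e) (le_lt_trans _ (ltrD iy jy))//.
  by rewrite (distrC (x j)) (le_trans _ (ler_normD _ _))// addrA subrK.
have Yinj t : G t -> injective (Y^~ t).
  move=> Gt i j /= Yij; have [_ Hi] := GY t Gt i; have [_ Hj] := GY t Gt j.
  by rewrite Yij in Hi; exact: close Hi Hj.
have Ysp t : G t -> splits (pencil P Q t) (Y^~ t).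
  move=> Gt; apply: inj_splits; first exact: regular_pencil_size.
    exact: Yinj.
  by move=> i; case: (GY t Gt i).
(* Continuity at [t] requires a root in every disc at all parameters near [t], which [near_join]
   provides. *)
exists Y; apply: filterS (near_join nG) => t nGt.
have Gt := nbhs_singleton nGt.
split; [|exact: Ysp|exact: Yinj].
move=> i; apply/cvgrPdist_lt => eta eta0.
have [Yr Yx] := GY t Gt i.
have r0 : 0 < e / 2 - `|x i - Y i t| by rewrite subr_gt0.
(* A root within [c] of [Y i t] stays in the disc of [x i], so it is the value of [Y i] again. *)
have [c [c0 ceta ce]] := positive_lower_bound eta0 r0.
apply: filterS2 nGt (pencil_near_root PQ Yr c0) => t' Gt' [y' y'r y'c].
have y'x : `|x i - y'| < e / 2.
  rewrite -(subrK (Y i t) (x i)) -addrA (le_lt_trans (ler_normD _ _))//.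
  by rewrite -ltrBrDl (lt_le_trans y'c).
have [_ _ ld] := PQ.
have [k y'k] := root_splits (Ysp t' Gt') (ld t') y'r.
have [_ Yk] := GY t' Gt' k.
have ik : i = k by apply: (close i k y') => //; rewrite y'k.
by rewrite [X in Y X t']ik -y'k; exact: lt_le_trans y'c ceta.
Qed.
(** The branches are separated at [t0], so a continuous root cannot move from one to another
    nearby. *)
Lemma continuous_root_locally d P Q t0 (Y : 'I_d -> R -> K^o) (f : R -> K^o) i :
    regular_pencil d P Q ->
    (forall j, {for t0, continuous (Y j)}) -> injective (Y^~ t0) ->
    (\forall t \near t0, splits (pencil P Q t) (Y^~ t)) ->
    {for t0, continuous f} -> f t0 = Y i t0 ->
  \forall t \near t0, root (pencil P Q t) (f t) -> f t = Y i t.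
Proof.
move=> [_ _ ld] Yc Yinj Ysp fc fY.
have [e e0 He] := values_separated (Y^~ t0).
have e20 : 0 < e / 2 by rewrite divr_gt0.
have nY := filter_forall (nbhs_filter t0)
  (fun j => continuous_near_dist (Yc j) e20).
apply: filterS3 Ysp nY (continuous_near_dist fc e20) => t st Yt ft rt.
have [k fk] := root_splits st (ld t) rt.
rewrite fk; congr (Y _ t); apply: Yinj; apply: He.
rewrite (splitr e) -fY (le_lt_trans _ (ltrD (Yt k) ft))//.
by rewrite (distrC (f t0)) -fk (le_trans _ (ler_normD _ _))// addrA subrK.
Qed.

(** Near each parameter both functions follow branches of a local selection, so agreement is locally
    constant on [[a, b]]. *)
Lemma continuous_root_unique d P Q a b (f g : R -> K^o) : a <= b ->
    regular_pencil d P Q ->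
    (forall t, a <= t <= b -> simple_roots (pencil P Q t)) ->
    (forall t, a <= t <= b -> {for t, continuous f}) ->
    (forall t, a <= t <= b -> {for t, continuous g}) ->
    (forall t, a <= t <= b -> root (pencil P Q t) (f t)) ->
    (forall t, a <= t <= b -> root (pencil P Q t) (g t)) ->
  f b = g b -> f a = g a.
Proof.
move=> ab PQ simp fc gc fr gr.
suff [] : f a = g a <-> f b = g b by [].
apply: (@locally_constant_itv _ (fun t => f t = g t)) => // t tab.
have [Y nY] := local_selection PQ (simp t tab).
have [Yc Ysp Yinj] := nbhs_singleton nY.
have [_ _ ld] := PQ.
have [i fi] := root_splits Ysp (ld t) (fr t tab).
have [j gj] := root_splits Ysp (ld t) (gr t tab).
have nYs : \forall t' \near t, splits (pencil P Q t') (Y^~ t').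
  by apply: filterS nY => t' [].
have nf := continuous_root_locally PQ Yc Yinj nYs (fc t tab) fi.
have ng := continuous_root_locally PQ Yc Yinj nYs (gc t tab) gj.
apply: filterS3 nY nf ng => u [_ _ Yu] fu gu uab.
rewrite (fu (fr u uab)) (gu (gr u uab)) fi gj.
by split=> [/Yu ->|/Yinj ->].
Qed.

(** * Gluing of selections along an interval *)

(** Continuity is global while the splitting concerns [[a, b]]: branches get extended by constants,
    which makes gluing an ordinary composition of continuous functions. *)
Definition selection d P Q a b (y : 'I_d -> R -> K^o) : Prop :=
  (forall i, continuous (y i)) /\
  forall t, a <= t <= b -> splits (pencil P Q t) (y^~ t).

Lemma selection_relabel d P Q a b (y : 'I_d -> R -> K^o) (r : 'I_d -> K) :
    a <= b -> regular_pencil d P Q ->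
    selection P Q a b y -> splits (pencil P Q b) r ->
  exists2 z : 'I_d -> R -> K^o, selection P Q a b z & forall i, z i b = r i.
Proof.
move=> ab [_ _ ld] [yc ysp] rs.
have /(splits_perm (ld b))/(_ rs)[s Hs] : splits (pencil P Q b) (y^~ b).
  by apply: ysp; rewrite ab lexx.
exists (fun i => y (s i)) => //; split=> [i|t /ysp yt]; first exact: yc.
rewrite /splits {1}yt; congr (_ *: _).
by rewrite (reindex_inj (@perm_inj _ s)).
Qed.

Lemma selection_cat d P Q a b c : a <= b -> b <= c -> regular_pencil d P Q ->
    (exists y : 'I_d -> R -> K^o, selection P Q a b y) ->
    (exists y : 'I_d -> R -> K^o, selection P Q b c y) ->
  exists y : 'I_d -> R -> K^o, selection P Q a c y.
Proof.
move=> ab bc PQ [y0 sy0] [z [zc zsp]].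
have zb : splits (pencil P Q b) (z^~ b) by apply: zsp; rewrite lexx.
have [y [yc ysp] yz] := selection_relabel ab PQ sy0 zb.
(* This is [y i t] for [t <= b] and [z i t] for [t >= b], because [y i b = z i b] after relabelling;
   continuity is visible from the formula. *)
exists (fun i t => y i (Num.min t b) + z i (Num.max t b) - z i b); split.
  move=> i t; apply: cvgB; last exact: cvg_cst.
  apply: cvgD.
    apply: (@continuous_comp _ _ _ (fun t => Num.min t b) (y i)); last exact: yc.
    by apply: continuous_min; [exact: cvg_id | exact: cvg_cst].
  apply: (@continuous_comp _ _ _ (fun t => Num.max t b) (z i)); last exact: zc.
  by apply: continuous_max; [exact: cvg_id | exact: cvg_cst].
move=> t /andP[ta tc] /=; have [tb|/ltW bt] := leP t b.
  apply: (@eq_splits _ _ (y^~ t)); last by apply: ysp; rewrite ta.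
  by move=> i /=; rewrite addrK.
apply: (@eq_splits _ _ (z^~ t)); last by apply: zsp; rewrite bt.
by move=> i /=; rewrite yz addrC addKr.
Qed.

Lemma selection_refl d P Q a : regular_pencil d P Q ->
  exists y : 'I_d -> R -> K^o, selection P Q a a y.
Proof.
move=> PQ; have [x xs] := splits_ex (regular_pencil_size a PQ).
exists (fun i _ => x i); split=> [i t|t]; first exact: cvg_cst.
by rewrite -eq_le => /eqP <-.
Qed.

Lemma selection_of_simple d P Q a b : a <= b -> regular_pencil d P Q ->
    (forall t, a <= t <= b -> simple_roots (pencil P Q t)) ->
  exists y : 'I_d -> R -> K^o, selection P Q a b y.
Proof.
move=> ab PQ simp.
suff [] : a <= b /\ exists y : 'I_d -> R -> K^o, selection P Q a b y by [].
apply: (@interval_chain R (fun u v =>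
  u <= v /\ exists y : 'I_d -> R -> K^o, selection P Q u v y)) => //.
  move=> u v w [uv suv] [vw svw]; split; first exact: le_trans uv vw.
  exact: selection_cat uv vw PQ suv svw.
move=> t tab; have [Y nY] := local_selection PQ (simp t tab).
have /nbhs_ballP[d0 d00 Hd] := nY.
near=> e => u v au ut tv vb eu ve; split; first exact: le_trans ut tv.
have de : e <= d0 by near: e; exact: nbhs_right_le.
have uv : u <= v by exact: le_trans ut tv.
have H s : u <= s <= v -> [/\ forall i, {for s, continuous (Y i)},
        splits (pencil P Q s) (Y^~ s) & injective (Y^~ s)].
  move=> /andP[us sv]; apply: Hd; rewrite /ball /= ltr_distlC.
  rewrite (le_lt_trans _ (lt_le_trans eu us)) ?lerB//=.
  by rewrite (le_lt_trans sv)// (lt_le_trans ve)// lerD.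
exists (fun i s => Y i (Num.max u (Num.min s v))); split.
  by move=> i; apply: continuous_clamp => // s /H[].
move=> s /andP[us sv] /=.
apply: (@eq_splits _ _ (Y^~ s)); last by have [] := H s; rewrite ?us.
by move=> i /=; rewrite (min_l sv) max_r.
Unshelve. all: by end_near. Qed.

(** The roots at [a] may be multiple here. Near [a] the values lie in disjoint discs around the
    distinct roots at [a]; by connectedness they stay in a single disc, and smaller discs then give
    convergence to its centre. *)
Lemma root_has_right_limit d P Q a b (f : R -> K^o) : a < b ->
    regular_pencil d P Q ->
    (forall t, a < t <= b -> {for t, continuous f}) ->
    (forall t, a < t <= b -> root (pencil P Q t) (f t)) ->
  exists x : K^o, f t @[t --> a^'+] --> x.
Proof.
move=> ab PQ fc fr.
have [x xs] := splits_ex (regular_pencil_size a PQ).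
have [e e0 He] := values_separated x.
have e20 : 0 < e / 2 by rewrite divr_gt0.
(* Only the values [x i] and [x j] agree, since different indices may carry the same root. *)
have close i j (y : K) : `|y - x i| < e / 2 -> `|y - x j| < e / 2 -> x i = x j.
  move=> iy jy; apply/He; rewrite (splitr e) (le_lt_trans _ (ltrD iy jy))//.
  by rewrite (distrC y (x i)) (le_trans _ (ler_normD _ _))// addrA subrK.
have /nbhs_ballP[r r0 Hr] := pencil_root_near PQ xs e20.
pose c := Num.min b (a + r / 2).
have ac : a < c by rewrite lt_min ab ltrDl divr_gt0.
have cb : c <= b by rewrite ge_min lexx.
have near_x t : a < t <= c -> exists i, `|f t - x i| < e / 2.
  move=> /andP[at_ tc]; apply: (Hr t); last first.
    by apply: fr; rewrite at_ (le_trans tc).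
  rewrite /ball /= ltr_distlC (lt_trans _ at_) ?ltrBlDr ?ltrDl//=.
  rewrite (le_lt_trans tc)// gt_min ltrD2l ltr_pdivrMr// ltr_pMr//.
  by rewrite ltr1n orbT.
have [|j fj] := near_x c; first by rewrite ac lexx.
have all_j t : a < t <= c -> `|f t - x j| < e / 2.
  move=> /andP[at_ tc].
  suff [_] : `|f t - x j| < e / 2 <-> `|f c - x j| < e / 2 by apply.
  apply: (@locally_constant_itv _ (fun t => `|f t - x j| < e / 2 : Prop)) => //.
  move=> u /andP[tu uc]; have au := lt_le_trans at_ tu.
  have [|k fk] := near_x u; first by rewrite au.
  have rk : 0 < e / 2 - `|f u - x k| by rewrite subr_gt0.
  have fcu : {for u, continuous f} by apply: fc; rewrite au (le_trans uc).
  apply: filterS (continuous_near_dist fcu rk) => v fv _.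
  have fkv : `|f v - x k| < e / 2.
    rewrite -(subrK (f u) (f v)) -addrA (le_lt_trans (ler_normD _ _))//.
    by rewrite -ltrBrDr distrC.
  split=> H; last first.
    by rewrite -(close k j (f u)).
  by rewrite -(close k j (f v)).
exists (x j); apply/cvgrPdist_lt => eta eta0.
have [h [h0 heta he]] := positive_lower_bound eta0 e20.
have nh := pencil_root_near PQ xs h0.
rewrite near_withinE.
have nc : \forall t \near a, t < c by exact: lt_nbhsl.
apply: filterS2 nh nc => t ht tc at_.
have atc : a < t <= c by rewrite at_ ltW.
have [|i fi] := ht (f t); first by apply: fr; rewrite at_ (le_trans (ltW tc)).
rewrite -(close i j (f t)).
- by rewrite distrC (lt_le_trans fi).
- by rewrite (lt_le_trans fi).
- exact: all_j.
Qed.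
(** Selections on [[u, b]] with a common labelling at [b] fit together as [u] decreases to [a]; each
    branch has a limit at [a], and these limits are the roots there. *)
Lemma selection_of_simple_right d P Q a b : a < b -> regular_pencil d P Q ->
    (forall t, a < t <= b -> simple_roots (pencil P Q t)) ->
  exists y : 'I_d -> R -> K^o, selection P Q a b y.
Proof.
move=> ab PQ simp.
have [r rs] := splits_ex (regular_pencil_size b PQ).
have [u|Z HZ] := @choice R ('I_d -> R -> K^o)
    (fun u z => a < u <= b -> selection P Q u b z /\ forall i, z i b = r i).
  have [/andP[au ub]|_] := boolP (a < u <= b); last by exists (fun _ _ => 0).
  have [|y sy] := selection_of_simple ub PQ.
    by move=> t /andP[ut tb]; apply: simp; rewrite (lt_le_trans au ut).
  by have [z sz zr] := selection_relabel ub PQ sy rs; exists z.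
have ZE u t i : a < u -> u <= t -> t <= b -> Z u i t = Z t i t.
  move=> au ut tb; have at_ := lt_le_trans au ut.
  have [|[uc us] ur] := HZ u; first by rewrite au (le_trans ut).
  have [|[tc ts] tr] := HZ t; first by rewrite at_.
  apply: (continuous_root_unique tb PQ).
  - by move=> v /andP[tv vb]; apply: simp; rewrite (lt_le_trans at_ tv).
  - by move=> v _; exact: uc.
  - by move=> v _; exact: tc.
  - move=> v /andP[tv vb]; apply: (splits_root i (us v _)).
    by rewrite (le_trans ut tv).
  - by move=> v tvb; exact: (splits_root i (ts v tvb)).
  - by rewrite ur tr.
(* By uniqueness, the continuations from [b] down to the various [u > a] agree. *)
pose G i t := Z (Num.min t b) i (Num.min t b).
have Gc i t : a < t -> {for t, continuous (G i)}.
  move=> at_; pose u := Num.min b ((a + t) / 2).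
  have au : a < u by rewrite lt_min ab midf_lt.
  have ub : u <= b by rewrite ge_min lexx.
  have ut : u < t by rewrite gt_min midf_lt ?orbT.
  apply: (@continuous_near_eq _ _ _ (fun t => Z u i (Num.min t b))).
    apply: filterS (lt_nbhsr ut) => v uv; rewrite /G -(@ZE u)//.
      by rewrite le_min (ltW uv).
    by rewrite ge_min lexx orbT.
  have [|[uc us] ur] := HZ u; first by rewrite au.
  apply: (@continuous_comp _ _ _ (fun t => Num.min t b) (Z u i)); last exact: uc.
  by apply: continuous_min; [exact: cvg_id | exact: cvg_cst].
have Gs t : a < t <= b -> splits (pencil P Q t) (G^~ t).
  move=> /andP[at_ tb]; have [|[tc ts] _] := HZ t; first by rewrite at_.
  apply: (@eq_splits _ _ ((Z t)^~ t)); last by apply: ts; rewrite lexx.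
  by move=> i; rewrite /G min_l.
have [i|x xl] := @choice _ _ (fun i (x : K^o) => G i t @[t --> a^'+] --> x).
  apply: (root_has_right_limit ab PQ).
    by move=> t /andP[at_ _]; exact: Gc.
  by move=> t /Gs; exact: splits_root.
pose y i t := if t <= a then x i else G i t.
have yG i t : a < t -> y i t = G i t by rewrite /y leNgt => ->.
exists y; split=> [i t|t /andP[]].
  have [at_|ta|<-] := ltgtP a t.
  - apply: (@continuous_near_eq _ _ _ (G i)); last exact: Gc.
    by apply: filterS (lt_nbhsr at_) => v; exact: yG.
  - apply: (@continuous_near_eq _ _ _ (fun=> x i)); last exact: cvg_cst.
    by apply: filterS (lt_nbhsl ta) => v /ltW; rewrite /y => ->.
  - apply/cvgrPdist_lt => e e0.
    have := xl i => /cvgrPdist_lt/(_ _ e0); rewrite near_withinE.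
    apply: filterS => v; rewrite /y lexx; case: leP => [_ _|av]; last exact.
    by rewrite subrr normr0.
rewrite le_eqVlt => /predU1P[<- _|at_ tb]; last first.
  apply: (@eq_splits _ _ (G^~ t)); last by apply: Gs; rewrite at_.
  by move=> i; rewrite yG.
apply: (@eq_splits _ _ x) => [i|]; first by rewrite /y lexx.
(* The factorization at [a] is the limit from the right of the factorizations at [t > a], evaluated
   at each fixed [z]. *)
apply: poly_ext => z; rewrite hornerZ horner_prod.
have h1 := cvg_at_right_filter (@pencil_horner_continuous P Q z a).
suff h2 : (pencil P Q t).[z] @[t --> a^'+] -->
    ((pencil P Q a)`_d * \prod_i ('X - (x i)%:P).[z] : K^o).
  exact: (cvg_unique (@norm_hausdorff _ K^o) h1 h2).
apply: (@cvg_trans _ ((pencil P Q t)`_d * \prod_i ('X - (G i t)%:P).[z] @[t --> a^'+])).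
  apply: near_eq_cvg; rewrite near_withinE; apply: filterS (lt_nbhsl ab) => v vb av.
  have /Gs Gsv : a < v <= b by rewrite av ltW.
  by rewrite -horner_prod -hornerZ -Gsv.
apply: cvgM; first exact: (cvg_at_right_filter (@pencil_coef_continuous P Q d a)).
apply: (@cvg_prod_family K R 'I_d (a^'+) _ (index_enum _)
  (fun i t => ('X - (G i t)%:P).[z]) (fun i => ('X - (x i)%:P).[z])) => i.
under eq_fun do rewrite hornerXsubC.
by rewrite hornerXsubC; apply: cvgB; [exact: cvg_cst | exact: xl].
Qed.

End Pencil.

(** Time reversal: continuation to the left becomes continuation to the right for the pencil with
    [- Q]. *)
Lemma selection_opp (R : realType) (K : numClosedFieldType)
    (iota : {rmorphism R -> K}) d (P Q : {poly K}) (a b : R)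
    (y : 'I_d -> R -> K^o) :
  selection iota P (- Q) (- b) (- a) y ->
  selection iota P Q a b (fun i t => y i (- t)).
Proof.
move=> [yc ys]; split=> [i t|t /andP[at_ tb]].
  apply: (@continuous_comp _ _ _ (fun t : R => - t) (y i)); last exact: yc.
  exact: oppr_continuous.
have := ys (- t); rewrite !lerN2 at_ tb => /(_ isT).
by rewrite /pencil rmorphN scaleNr scalerN opprK.
Qed.

(** Parameters with multiple roots are isolated, so each [t] has simple roots on both sides near it;
    one-sided selections are joined at [t], and the resulting windows are chained along [[a, b]]. *)
Lemma selection_exists (R : realType) (K : numClosedFieldType)
    (iota : {rmorphism R -> K}) (iota_continuous : continuous (iota : R -> K^o))
    d (P Q : {poly K}) (a b : R) : a <= b -> regular_pencil iota d P Q ->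
    (forall t, \forall u \near t^', simple_roots (pencil iota P Q u)) ->
  exists y : 'I_d -> R -> K^o, selection iota P Q a b y.
Proof.
move=> ab PQ simp; pose sel u v :=
  exists y : 'I_d -> R -> K^o, selection iota P Q u v y.
suff [] : a <= b /\ sel a b by [].
apply: (@interval_chain R (fun u v => u <= v /\ sel u v)) => //.
  move=> u v w [uv suv] [vw svw]; split; first exact: le_trans uv vw.
  exact: selection_cat uv vw PQ suv svw.
move=> t _; have := simp t; rewrite near_withinE => /nbhs_ballP[r r0 Hr].
near=> e => u v _ ut tv _ eu ve; split; first exact: le_trans ut tv.
have er : e <= r by near: e; exact: nbhs_right_le.
apply: (selection_cat ut tv PQ).
  move: ut; rewrite le_eqVlt => /predU1P[->|ut]; first exact: selection_refl.
  have [|||y sy] := @selection_of_simple_right _ _ iota iota_continuous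
      d P (- Q) (- t) (- u).
  - by rewrite ltrN2.
  - exact: regular_pencil_opp.
  - move=> s /andP[ts su].
    have -> : pencil iota P (- Q) s = pencil iota P Q (- s).
      by rewrite /pencil rmorphN scaleNr scalerN.
    have nst : - s < t by rewrite ltrNl.
    apply: Hr; last by rewrite lt_eqF.
    rewrite /ball /= ltr_distlC (lt_trans nst) ?ltrDl// andbT.
    by rewrite (le_lt_trans _ (lt_le_trans eu _)) ?lerB// lerNr.
  by exists (fun i t => y i (- t)); exact: selection_opp.
move: tv; rewrite le_eqVlt => /predU1P[<-|tv]; first exact: selection_refl.
apply: selection_of_simple_right => // s /andP[ts sv].
apply: Hr; last by rewrite gt_eqF.
rewrite /ball /= ltr_distlC (lt_trans _ ts) ?ltrBlDr ?ltrDl//=.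
by rewrite (le_lt_trans sv)// (lt_le_trans ve)// lerD.
Unshelve. all: by end_near. Qed.
(** * Wronskian and projective coordinate *)

Lemma deriv_eq0_size (K : numFieldType) (p : {poly K}) :
  p^`() = 0 -> (size p <= 1)%N.
Proof.
move=> p0; apply/leq_sizeP => -[//|k] _; apply/eqP.
by have /eqP := coef_deriv p k; rewrite p0 coef0 eq_sym mulrn_eq0.
Qed.

(** This is the numerator of the derivative of [Q / P], with denominator [P ^+ 2]. *)
Definition wronskian (K : fieldType) (P Q : {poly K}) : {poly K} :=
  P * Q^`() - P^`() * Q.

(** If it vanished, [P] would divide [P^]() * Q[, hence]P^[()] by coprimality, against the degrees
    in characteristic 0. *)
Lemma wronskian_neq0 (K : numFieldType) (P Q : {poly K}) :
  coprimep P Q -> (1 < size P)%N -> wronskian P Q != 0.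
Proof.
move=> PQ sP; apply/eqP => /eqP; rewrite subr_eq0 => /eqP W.
have : P %| P^`() by rewrite -(Gauss_dvdpl _ PQ) -W dvdp_mulr.
have [/deriv_eq0_size|P'0] := eqVneq P^`() 0; first by rewrite leqNgt sP.
move/(dvdp_leq P'0); rewrite leqNgt lt_size_deriv//.
by apply: contraTneq sP => ->; rewrite size_poly0.
Qed.

Lemma wronskian_root (K : fieldType) (P Q : {poly K}) (a c x : K) :
    (a *: P + c *: Q).[x] = 0 -> (a *: P + c *: Q)^`().[x] = 0 ->
  a * (wronskian P Q).[x] = 0.
Proof.
rewrite derivD !derivZ !hornerE => /eqP; rewrite addr_eq0 => /eqP Px.
move=> /eqP; rewrite addr_eq0 => /eqP P'x.
by rewrite mulrBr !mulrA Px P'x; ring.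
Qed.

(** With [F = a *: P + c *: Q] and [W] the Wronskian, [P * F^]() = c *: W + P^[() * F]. *)
Lemma root_deriv_wronskian (K : fieldType) (P Q : {poly K}) (a c x : K) :
    P.[x] != 0 -> (wronskian P Q).[x] = 0 -> (a *: P + c *: Q).[x] = 0 ->
  (a *: P + c *: Q)^`().[x] = 0.
Proof.
move=> Px W0 PQx; apply: (mulfI Px); rewrite mulr0.
transitivity (c * (wronskian P Q).[x] + P^`().[x] * (a *: P + c *: Q).[x]).
  by rewrite /wronskian derivD !derivZ !hornerE; ring.
by rewrite W0 PQx !mulr0 addr0.
Qed.

(** Multiple roots are among the finitely many roots of the Wronskian. Each of these is a root of
    the pencil for at most one parameter, since [P] and [Q] do not both vanish there. *)
Lemma pencil_simple_near (R : realType) (K : numClosedFieldType)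
    (iota : {rmorphism R -> K}) (iota_continuous : continuous (iota : R -> K^o))
    (P Q : {poly K}) (t : R) : coprimep P Q -> (1 < size P)%N ->
  \forall u \near t^', simple_roots (pencil iota P Q u).
Proof.
move=> PQ sP; have W0 := wronskian_neq0 PQ sP.
have [r Dr] := closed_field_poly_normal (wronskian P Q).
have : \forall u \near t^', forall y, y \in r -> (pencil iota P Q u).[y] != 0.
  elim: r {Dr} => [|y r IH]; first exact: nearW.
  suff : \forall u \near t^', (pencil iota P Q u).[y] != 0.
    by apply: filterS2 IH => u ur uy z; rewrite inE => /predU1P[->|/ur].
  have [ty|ty] := eqVneq (pencil iota P Q t).[y] 0; last first.
    apply: nbhs_dnbhs.
    exact: cvgr_neq0 (@pencil_horner_continuous _ _ _ iota_continuous P Q y t) ty.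
  apply: filterS (nbhs_dnbhs_neq t) => u; apply: contraNneq => uy.
  move: ty uy; rewrite !pencil_horner => /eqP ty /eqP uy.
  have [Qy|Qy] := eqVneq Q.[y] 0.
    move: ty; rewrite Qy mulr0 addr0 => Py.
    by move/coprimep_root: PQ => /(_ _ Py); rewrite Qy eqxx.
  rewrite -(inj_eq (fmorph_inj iota)) -(inj_eq (mulIf Qy)).
  by rewrite -(inj_eq (addrI P.[y])) (eqP ty) (eqP uy).
apply: filterS => u ur x xr; apply/negP => x'r.
have /ur/negP : x \in r.
  have : root (wronskian P Q) x.
    apply/eqP; rewrite -[LHS]mul1r.
    by apply: (@wronskian_root _ _ _ _ (iota u)); rewrite scale1r; apply/eqP.
  by rewrite Dr rootZ ?lead_coef_eq0// root_prod_XsubC.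
by apply.
Qed.

(* For [size p <= d.+1] this is [y ^+ d * p.[w + y^-1]]: the coordinate
   [y = (x - w)^-1] moves the point at infinity to [y = 0] and [w] to infinity. *)
Definition chart (K : fieldType) (d : nat) (w : K) (p : {poly K}) : {poly K} :=
  \poly_(i < d.+1) (p \Po ('X + w%:P))`_(d - i).

Section Chart.
Context {K : fieldType} (d : nat) (w : K).
Implicit Types p q : {poly K}.

Lemma chartD p q : chart d w (p + q) = chart d w p + chart d w q.
Proof.
apply/polyP => i; rewrite coefD !coef_poly comp_polyD coefD.
by case: ifP => // _; rewrite addr0.
Qed.

Lemma chartZ c p : chart d w (c *: p) = c *: chart d w p.
Proof.
apply/polyP => i; rewrite coefZ !coef_poly comp_polyZ coefZ.
by case: ifP => // _; rewrite mulr0.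
Qed.

Lemma size_comp_shift p : size (p \Po ('X + w%:P)) = size p.
Proof. by apply: size_comp_poly2; rewrite size_XaddC. Qed.

Lemma chart_horner p y : (size p <= d.+1)%N -> y != 0 ->
  (chart d w p).[y] = y ^+ d * p.[w + y^-1].
Proof.
move=> sp y0; have -> : p.[w + y^-1] = (p \Po ('X + w%:P)).[y^-1].
  by rewrite horner_comp !hornerE addrC.
rewrite horner_poly (@horner_coef_wide _ d.+1) ?size_comp_shift// mulr_sumr.
rewrite (reindex_inj rev_ord_inj); apply: eq_bigr => i _ /=.
have id_ : (i <= d)%N by rewrite -ltnS.
rewrite subSS subKn// mulrCA; congr (_ * _).
by rewrite exprVn expfB_cond ?(negPf y0)//= exprB ?unitfE.
Qed.

(** A pencil is therefore regular in this coordinate as soon as it never vanishes at [w]. *)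
Lemma chart_lead p : (chart d w p)`_d = p.[w].
Proof. by rewrite coef_poly ltnSn subnn -horner_coef0 horner_comp !hornerE. Qed.

Lemma chart_horner0 p : size p = d.+1 -> (chart d w p).[0] != 0.
Proof.
move=> sp; rewrite horner_coef0 coef_poly /= subn0.
have := lead_coef_eq0 (p \Po ('X + w%:P)); rewrite lead_coefE size_comp_shift sp /= => ->.
by rewrite -size_poly_eq0 size_comp_shift sp.
Qed.

End Chart.

(** The roots are followed on the projective line: the factor of [y i t] vanishes at
    [w + (y i t)^-1], and it is the constant 1, standing for a root at infinity, when
    [y i t = 0]. *)
Lemma projective_selection (R : realType) (K : numClosedFieldType)
    (iota : {rmorphism R -> K}) (iota_continuous : continuous (iota : R -> K^o))
    (d : nat) (D N : {poly K}) (eps : K) :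
    eps ^+ 2 = 1 -> (0 < d)%N -> maxn (size D) (size N) = d.+1 ->
    D \is monic -> N \is monic -> coprimep D N ->
  exists (w : K) (y : 'I_d -> R -> K^o),
    [/\ forall i, continuous (y i),
        forall i t u, 0 <= t <= 1 -> 0 <= u <= 1 ->
          y i t = 0 -> y i u = 0 -> t = u
      & forall t, 0 <= t <= 1 -> exists2 l : K, l != 0 &
          (1 - iota t) *: D - (iota t * eps) *: N =
            l *: \prod_i (1 - (y i t : K)%:P * ('X - w%:P))].
Proof.
move=> eps2 d0 sDN Dm Nm DN.
have sD : (size D <= d.+1)%N by rewrite -sDN leq_maxl.
have sN : (size N <= d.+1)%N by rewrite -sDN leq_maxr.
pose j : K := 'i%R; have j2 : j ^+ 2 = -1 := sqrCi K.
have j1 : j != 1.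
  apply/eqP => j1; move: j2; rewrite j1 expr1n => /eqP.
  by rewrite -subr_eq0 opprK -mulr2n pnatr_eq0.
have cd (p : {poly K}) : p \is monic -> (size p <= d.+1)%N ->
    p`_d = (size p == d.+1)%:R.
  move=> /monicP pm; rewrite leq_eqVlt ltnS => /predU1P[sp|sp].
    by rewrite sp eqxx; move: pm; rewrite lead_coefE sp.
  by rewrite nth_default// (ltn_eqF (_ : (_ < _)%N)).
have e0 : eps != 0 by rewrite -sqrf_eq0 eps2 oner_eq0.
(* [N.[w] = j * D.[w]] with [j ^+ 2 = -1], so the pencil takes at [w] the value
   [(1 - t - eps * j * t) * D.[w]], nonzero for every real [t]: no root of the
   pencil ever passes through [w]. *)
have [w /eqP] : exists w, root (N - j *: D) w.
  apply/closed_rootP; rewrite neq_ltn; apply/orP; right.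
  (* By monicity the coefficients of degree [d] are 0 or 1, not both 0, and [j] is neither 0 nor 1.
     Hence the polynomial has degree [d > 0] and a root. *)
  have : (N - j *: D)`_d != 0.
    rewrite coefB coefZ !cd// subr_eq0.
    move: sDN; case: (size D =P d.+1) => [_|D1]; case: (size N =P d.+1) => [_|N1].
    - by rewrite mulr1 eq_sym.
    - by rewrite mulr1 eq_sym -sqrf_eq0 j2 oppr_eq0 oner_eq0.
    - by rewrite mulr0 oner_eq0.
    - by rewrite /maxn; case: ifP.
  apply: contraR; rewrite -leqNgt => s1; rewrite nth_default//.
  by rewrite (leq_trans s1).
rewrite !hornerE => /eqP; rewrite subr_eq0 => /eqP Nw.
have Dw : D.[w] != 0.
  apply/eqP => Dw; have := coprimep_root DN (introT eqP Dw).
  by rewrite Nw Dw mulr0 eqxx.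
have [Q QE] : exists Q, Q = (-1) *: D + (- eps) *: N by eexists.
have PtE t : D + iota t *: Q = (1 - iota t) *: D - (iota t * eps) *: N.
  by rewrite QE scaleN1r scaleNr scalerBr scalerN scalerA scalerBl scale1r addrA.
have sQ : (size Q <= d.+1)%N.
  rewrite QE (leq_trans (size_polyD _ _))// geq_max.
  by rewrite !(leq_trans (size_scale_leq _ _)).
have pencilE t : pencil iota (chart d w D) (chart d w Q) t = chart d w (D + iota t *: Q).
  by rewrite /pencil chartD chartZ.
have ld t : (D + iota t *: Q).[w] != 0.
  rewrite PtE !hornerE Nw mulrA -mulrBl mulf_neq0//; apply/eqP => H.
  (* Squaring [1 - t = eps * j * t] gives [(1 - t) ^+ 2 = - t ^+ 2], impossible for real [t]. *)
  have : iota ((1 - t) ^+ 2 + t ^+ 2) = 0.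
    move/eqP: H; rewrite subr_eq0 => /eqP H.
    rewrite rmorphD !rmorphXn rmorphB rmorph1 H !exprMn eps2 j2; ring.
  move/eqP; rewrite fmorph_eq0 paddr_eq0 ?sqr_ge0// !sqrf_eq0 subr_eq0.
  by case/andP => /eqP <-; rewrite oner_eq0.
have reg : regular_pencil iota d (chart d w D) (chart d w Q).
  split; [exact: size_poly|exact: size_poly|move=> t].
  by rewrite pencilE chart_lead.
(* A common root [y != 0] gives the common root [w + y^-1] of [D] and [N]; the root 0 would make
   both degrees smaller than [d]. *)
have cop : coprimep (chart d w D) (chart d w Q).
  apply: Pdiv.ClosedField.root_coprimep => y /eqP Dy; apply/eqP => Qy.
  have [y0|y0] := eqVneq y 0.
    move: Dy Qy; rewrite y0 QE chartD !chartZ hornerD !hornerZ.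
    move=> Dy; rewrite Dy mulr0 add0r => /eqP.
    rewrite mulf_eq0 oppr_eq0 (negPf e0) /= => Ny.
    move: sDN; rewrite /maxn; case: ifP => _ s.
      by have := chart_horner0 w s; rewrite Ny.
    by have := chart_horner0 w s; rewrite Dy eqxx.
  move: Dy Qy; rewrite !chart_horner// => /eqP.
  rewrite mulf_eq0 expf_eq0 (negPf y0) andbF /= => Dy /eqP.
  rewrite mulf_eq0 expf_eq0 (negPf y0) andbF /= QE !hornerE (eqP Dy).
  rewrite mulr0 add0r mulf_eq0 oppr_eq0 (negPf e0) /=.
  by have := coprimep_root DN Dy => /negPf ->.
have s1 : (1 < size (chart d w D))%N.
  rewrite ltnNge; apply: contra Dw => s1; rewrite -(chart_lead d) nth_default//.
  by rewrite (leq_trans s1).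
have [y [yc ys]] := selection_exists iota_continuous (@ler01 R) reg
  (fun t => pencil_simple_near iota_continuous t cop s1).
exists w, y; split=> // [i t u t01 u01 yt yu|t t01].
  have := splits_root i (ys t t01); have := splits_root i (ys u u01).
  rewrite yt yu /root !pencil_horner => /eqP Hu /eqP Ht.
  (* The value at 0 is affine in the parameter and, by coprimality, not identically zero, so a
     branch reaches infinity at most once. *)
  have /eqP : (iota t - iota u) * (chart d w Q).[0] = 0.
    transitivity ((chart d w D).[0] + iota t * (chart d w Q).[0]
      - ((chart d w D).[0] + iota u * (chart d w Q).[0])); first by ring.
    by rewrite Ht Hu subrr.
  rewrite mulf_eq0 subr_eq0 (inj_eq (fmorph_inj iota)) => /orP[/eqP//|/eqP Q0].
  move: Ht; rewrite Q0 mulr0 addr0 => /eqP D0.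
  by have := coprimep_root cop D0; rewrite Q0 eqxx.
exists (D + iota t *: Q).[w]; first exact: ld.
(* At [x = w] every factor is 1; elsewhere the splitting of the chart is evaluated at [(x - w)^-1]
   and multiplied by [(x - w) ^+ d]. *)
rewrite -PtE; apply: poly_ext => x; rewrite hornerZ horner_prod.
have [->|xw] := eqVneq x w.
  by rewrite big1 ?mulr1// => i _; rewrite !hornerE subrr mulr0 subr0.
have xw0 : x - w != 0 by rewrite subr_eq0.
have := splits_horner (x - w)^-1 (ys t t01).
rewrite pencilE chart_lead chart_horner ?invr_eq0//; last first.
  rewrite (leq_trans (size_polyD _ _))// geq_max sD.
  by rewrite (leq_trans (size_scale_leq _ _)).
rewrite invrK addrCA subrr addr0 => /(congr1 (fun u => (x - w) ^+ d * u)).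
rewrite exprVn mulVKf ?expf_neq0// => ->.
rewrite mulrCA; congr (_ * _).
rewrite -[X in _ ^+ X]card_ord -prodr_const -big_split; apply: eq_bigr => i _ /=.
by rewrite !hornerE mulrBr divff// [in RHS]mulrC.
Qed.
(** * Local study of polynomials *)

Lemma is_derive_horner (K : numFieldType) (p : {poly K}) (x : K^o) :
  is_derive x (1 : K^o) (fun u : K^o => p.[u] : K^o) p^`().[x].
Proof.
elim/poly_ind: p => [|p c IH].
  have -> : (fun u : K^o => (0 : {poly K}).[u] : K^o) = cst 0.
    by apply/funext => u; rewrite horner0.
  by rewrite deriv0 horner0; exact: is_derive_cst.
have -> : (fun u : K^o => (p * 'X + c%:P).[u] : K^o) =
    (fun u : K^o => p.[u] : K^o) * id + cst c.
  by apply/funext => u; rewrite !hornerE.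
apply: is_derive_eq.
rewrite derivD derivM derivX derivC !hornerE /GRing.scale /=.
by rewrite mulr1 addrC mulrC.
Qed.

Lemma horner_continuous (K : numFieldType) (p : {poly K}) :
  continuous (fun u : K^o => p.[u] : K^o).
Proof.
move=> x; apply: differentiable_continuous; apply/derivable1_diffP.
by have [] := is_derive_horner p x.
Qed.

(** The two-variable difference quotient, extended to the diagonal; for [p * 'X + c%:P] it is [G (x,
    y) * x + p.[y]]. *)
Lemma horner_diff_quotient (K : numFieldType) (p : {poly K}) (s : K^o) :
  exists G : K^o * K^o -> K^o,
    [/\ forall x y, p.[x] - p.[y] = (x - y) * G (x, y),
        {for (s, s), continuous G} & G (s, s) = p^`().[s]].
Proof.
elim/poly_ind: p => [|p c [G [GE Gc Gs]]].
  exists (fun=> 0); split=> [x y||]; last by rewrite deriv0 horner0.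
  - by rewrite !horner0 subrr mulr0.
  - exact: cvg_cst.
exists (fun q => G q * q.1 + p.[q.2]); split=> [x y||].
- rewrite !hornerE /=; have -> : p.[x] = p.[y] + (x - y) * G (x, y).
    by rewrite -GE addrC subrK.
  ring.
- apply: cvgD; first by apply: cvgM; [exact: Gc | exact: cvg_fst].
  apply: (@continuous_comp _ _ _ (@snd K^o K^o) (fun u : K^o => p.[u] : K^o)).
    exact: cvg_snd.
  exact: horner_continuous.
- by rewrite derivD derivM derivX derivC !hornerE Gs.
Qed.

(** [N.[x] * D.[y] - N.[y] * D.[x]] is [x - y] times a function continuous at [(s, s)], whose value
    there is the Wronskian at [s]. *)
Lemma ratio_locally_injective (K : numFieldType) (D N : {poly K}) (s : K^o) :
    (wronskian D N).[s] != 0 ->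
  exists2 V : set K^o, nbhs s V & forall x y, V x -> V y ->
    N.[x] * D.[y] = N.[y] * D.[x] -> x = y.
Proof.
move=> W0.
have [GD [GDE GDc GDs]] := horner_diff_quotient D s.
have [GN [GNE GNc GNs]] := horner_diff_quotient N s.
pose G (q : K^o * K^o) : K^o := GN q * D.[q.2] - N.[q.2] * GD q.
have Gc : {for (s, s), continuous G}.
  have h (p : {poly K}) : {for (s, s), continuous (fun q : K^o * K^o => p.[q.2] : K^o)}.
    apply: (@continuous_comp _ _ _ (@snd K^o K^o) (fun u : K^o => p.[u] : K^o)).
      exact: cvg_snd.
    exact: horner_continuous.
  by apply: cvgB; apply: cvgM => //; exact: h.
have Gs : G (s, s) != 0.
  by rewrite /G GNs GDs /= mulrC [X in _ - X]mulrC; move: W0; rewrite /wronskian !hornerE.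
have [[A B] /= [As Bs] AB] := cvgr_neq0 (G (s, s)) Gc Gs.
exists (A `&` B); first exact: filterI.
move=> x y [Ax _] [_ By] E; apply/eqP; rewrite -subr_eq0.
have := AB (x, y) (conj Ax By); rewrite /= => /negPf Gxy.
have : (x - y) * G (x, y) = 0.
  transitivity ((N.[x] - N.[y]) * D.[y] - N.[y] * (D.[x] - D.[y])).
    by rewrite GNE GDE /G /=; ring.
  by rewrite mulrBl mulrBr E; ring.
by move/eqP; rewrite mulf_eq0 Gxy orbF.
Qed.

Lemma isolated_root (K : numFieldType) (p : {poly K}) (s : K^o) : p != 0 ->
  \forall x \near s, p.[x] = 0 -> x = s.
Proof.
move=> p0; have [k [q + Dp]] := multiplicity_XsubC p s; rewrite p0 /= => qs.
apply: filterS (cvgr_neq0 q.[s] (@horner_continuous _ q s) qs) => x qx.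
rewrite Dp hornerM horner_exp hornerXsubC => /eqP.
by rewrite mulf_eq0 (negPf qx) expf_eq0 subr_eq0 => /andP[_ /eqP].
Qed.

Lemma norm_addV_large (K : numFieldType) (T : Type) (F : set_system T)
    (FF : Filter F) (w B : K) (u : T -> K^o) : 0 <= B ->
    u t @[t --> F] --> (0 : K^o) -> (\forall t \near F, u t != 0) ->
  \forall t \near F, B <= `|w + (u t : K)^-1|.
Proof.
move=> B0 /cvgrPdist_lt u0 un0.
have e1 : 0 < (B + `|w| + 1)^-1 by rewrite invr_gt0 ltr_wpDl// addr_ge0.
apply: filterS2 un0 (u0 _ e1) => t ut; rewrite sub0r normrN => ute.
have : B + `|w| + 1 <= `|(u t : K)^-1|.
  rewrite normfV -[leLHS]invrK lef_pV2 ?posrE ?normr_gt0 ?invr_gt0//.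
    exact: ltW.
  by rewrite -invr_gt0.
rewrite -lerBrDr => H.
rewrite -(lerD2r `|w|) (le_trans _ (_ : `|(u t : K)^-1| <= _))//.
  by rewrite (le_trans H)// gerBl ler01.
rewrite -{1}[(u t : K)^-1](addrK w) (le_trans (ler_normB _ _))//.
by rewrite [_ + w]addrC.
Qed.
(** * Root loci *)

(** One factor vanishes at [s]; its derivative [- y i] is nonzero, so the product rule forces
    another factor to vanish as well. *)
Lemma moebius_prod_double_root (K : fieldType) (I : finType) (q : {poly K})
    (l w s : K) (y : I -> K) : l != 0 ->
    q = l *: \prod_k (1 - (y k)%:P * ('X - w%:P)) -> root q s -> root q^`() s ->
  exists i j, [/\ i != j, y i * (s - w) = 1 & y j * (s - w) = 1].
Proof.
move=> l0 -> /eqP; rewrite hornerZ horner_prod => /eqP.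
rewrite mulf_eq0 (negPf l0) /= => /prodf_eq0[i _].
rewrite !hornerE subr_eq0 eq_sym => /eqP yi.
rewrite /root derivZ hornerZ mulf_eq0 (negPf l0) /= (bigD1 i)//= derivM hornerD.
rewrite [X in _ + X]hornerM [X in _ + X * _]hornerE !hornerE yi subrr mul0r addr0.
move=> H; have yi0 : y i != 0.
  by apply: contra_eq_neq yi => ->; rewrite mul0r eq_sym oner_eq0.
move: H; rewrite !poly.derivE !hornerE mulf_eq0 oppr_eq0.
rewrite subr0 mulr1 (negPf yi0) /=.
rewrite horner_prod => /prodf_eq0[j ji].
rewrite !hornerE subr_eq0 eq_sym => /eqP yj.
by exists i, j; split; rewrite // eq_sym.
Qed.

(** * Factored polynomials and continuity in [R[i]] *)

Section Factored.
Context {R : realType} {k : nat} (a : 'I_k -> R[i]) (e : 'I_k -> nat).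

Lemma fpoly_horner (s : R[i]) : (fpoly a e).[s] = feval a e s.
Proof.
by rewrite horner_prod; apply: eq_bigr => i _; rewrite horner_exp hornerXsubC.
Qed.

Lemma fpoly_monic : fpoly a e \is monic.
Proof. by apply: monic_prod => i _; rewrite monic_exp// monicXsubC. Qed.

Lemma feval_eq0 (s : R[i]) : feval a e s = 0 -> exists i, s = a i.
Proof.
move/eqP/prodf_eq0 => [i _]; rewrite expf_eq0 subr_eq0 => /andP[_ /eqP].
by exists i.
Qed.

Lemma size_fpoly_gt1 : (forall i, 0 < e i)%N -> (0 < k)%N -> (1 < size (fpoly a e))%N.
Proof.
move=> e0 k0; apply: (root_size_gt1 (a := a (Ordinal k0))).
  exact: monic_neq0 fpoly_monic.
by rewrite /root fpoly_horner /feval (bigD1 (Ordinal k0))//= subrr expr0n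
  gtn_eqF ?mul0r.
Qed.

End Factored.

Lemma real_complex_continuous (R : realType) :
  continuous (real_complex R : R -> R[i]^o).
Proof.
move=> t; apply/cvgrPdist_lt => e e0.
have De : e = (complex.Re e)%:C by rewrite RRe_real// gtr0_real.
have e0' : 0 < complex.Re e by rewrite -ltcR -De.
have := @cvgr_dist_lt _ _ _ (nbhs t) (nbhs_filter t) id t cvg_id _ e0'.
apply: filterS => u.
have -> : (t%:C : R[i]) - u%:C = (t - u)%:C by rewrite rmorphB.
by rewrite normc_def /= expr0n addr0 sqrtr_sqr {2}De ltcR.
Qed.

Lemma Re_continuous (R : realType) :
  continuous (fun x : R[i]^o => complex.Re x : R).
Proof.
move=> x; apply/(@cvgrPdist_lt _ _ _ (nbhs x) (nbhs_filter x)) => e e0.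
have e0' : 0 < (e%:C : R[i]) by rewrite ltcR.
have idc : {for x, continuous (@id R[i]^o)} by exact: cvg_id.
apply: filterS (continuous_near_dist idc e0') => y xy; rewrite -ltcR.
have -> : complex.Re x - complex.Re y = complex.Re ((x : R[i]) - y).
  by case: (x : R[i]) (y : R[i]) => [? ?] [? ?].
exact: le_lt_trans (normc_ge_Re _) xy.
Qed.

Lemma tends_to_infinity_addV (R : realType) (F : set_system R) (FF : Filter F)
    (w : R[i]) (u : R -> R[i]^o) :
    u t @[t --> F] --> (0 : R[i]^o) -> (\forall t \near F, u t != 0) ->
  tends_to_infinity (fun t => w + (u t : R[i])^-1 : R[i]^o) F.
Proof.
move=> u0 un0; apply/cvgryPge => A.
have A0 : 0 <= (`|A|%:C : R[i]) by rewrite lecR.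
apply: filterS (norm_addV_large FF w A0 u0 un0) => t.
by rewrite lecE => /andP[_]; apply: le_trans; exact: ler_norm.
Qed.

(** * Critical points of [RF] and of its gain *)

Section Loci.
Context {R : realType} {m n : nat}.
Context (z : 'I_m -> R[i]) (gamma : 'I_m -> nat).
Context (p : 'I_n -> R[i]) (beta : 'I_n -> nat).
Hypothesis gamma_gt0 : forall l, (0 < gamma l)%N.
Hypothesis beta_gt0 : forall j, (0 < beta j)%N.
Hypothesis z_neq_p : forall l j, z l <> p j.
Hypothesis mn_gt0 : (0 < m + n)%N.

Let N := fpoly z gamma.
Let D := fpoly p beta.
Local Notation gain := (gain z gamma p beta).
Local Notation RF := (RF z gamma p beta).

Lemma fpoly_coprime : coprimep D N.
Proof.
apply: Pdiv.ClosedField.root_coprimep => x /eqP; rewrite !fpoly_horner.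
move=> /feval_eq0[j ->]; apply/eqP => /feval_eq0[l pz].
exact: (z_neq_p (esym pz)).
Qed.

(** Without poles [D] is constant; the roles of [D] and [N] are then exchanged, [N] being
    nonconstant. *)
Lemma fpoly_wronskian_neq0 : wronskian D N != 0.
Proof.
have [n0|n0] := posnP n; last first.
  by apply: wronskian_neq0; [exact: fpoly_coprime | exact: size_fpoly_gt1].
have : wronskian N D != 0.
  apply: wronskian_neq0; first by rewrite coprimep_sym fpoly_coprime.
  by apply: size_fpoly_gt1 => //; move: mn_gt0; rewrite n0 addn0.
have -> : wronskian D N = - wronskian N D by rewrite /wronskian; ring.
by rewrite oppr_eq0.
Qed.

Lemma Phi_horner_neq0 (s : R[i]) : Phi z p s -> D.[s] != 0 /\ N.[s] != 0.
Proof.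
move=> [sz sp]; rewrite !fpoly_horner; split; apply/eqP => /feval_eq0[i si].
  exact: (sp i).
exact: (sz i).
Qed.

Lemma is_derive_RF (s : R[i]^o) : D.[s] != 0 ->
  is_derive s (1 : R[i]^o) RF ((wronskian D N).[s] / D.[s] ^+ 2).
Proof.
move=> Ds.
have -> : RF = (fun x : R[i]^o => N.[x] : R[i]^o) * (fun x : R[i]^o => (D.[x])^-1 : R[i]^o).
  by apply/funext => x; rewrite /RF -!fpoly_horner.
have dN := is_derive_horner N s.
have dD := is_derive_horner D s.
have dV : is_derive s (1 : R[i]^o) (fun x : R[i]^o => (D.[x])^-1 : R[i]^o)
    (- D.[s] ^- 2 *: D^`().[s]).
  have [dD1 dD2] := dD; split; first exact: derivableV.
  by rewrite deriveV// dD2.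
apply: is_derive_eq; rewrite /wronskian hornerD hornerN !hornerM.
have scaleE (a b : R[i]) : (a : R[i]^o) *: (b : R[i]^o) = a * b by [].
by rewrite !scaleE; field.
Qed.

Lemma critical_point_RF (s : R[i]^o) : D.[s] != 0 ->
  critical_point RF s <-> (wronskian D N).[s] = 0.
Proof.
move=> Ds; have dRF := is_derive_RF Ds; split=> [[_ d0]|W0].
  have [_ d1] := dRF; move: d1; rewrite d0 => /esym/eqP.
  by rewrite mulf_eq0 invr_eq0 expf_eq0 (negPf Ds) orbF => /eqP.
by rewrite /critical_point; move: dRF; rewrite W0 mul0r.
Qed.

Lemma critical_point_inv (f : R[i]^o -> R[i]^o) (c s : R[i]^o) :
  f s != 0 -> critical_point f s -> critical_point (fun x => c * (f x)^-1) s.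
Proof.
move=> fs [df f0].
have dV : is_derive s (1 : R[i]^o) (fun x : R[i]^o => (f x)^-1 : R[i]^o) 0.
  split; first exact: derivableV.
  by rewrite deriveV// f0 scaler0.
rewrite /critical_point.
have -> : (fun x => c * (f x)^-1) = cst c * (fun x : R[i]^o => (f x)^-1 : R[i]^o) by [].
by apply: is_derive_eq; rewrite !scaler0 addr0.
Qed.

(** The identity holds even at zeros and poles, because the inverse of 0 is 0. *)
Lemma gain_RF (b : bool) : gain b = fun x => (-1) ^+ b * (RF x)^-1.
Proof. by apply/funext => x; rewrite /gain /RF invf_div. Qed.

Lemma RF_gain (b : bool) : RF = fun x => (-1) ^+ b * (gain b x)^-1.
Proof.
apply/funext => x; rewrite gain_RF invfM invrK mulrA -exprVn invrN1.
by rewrite -exprMn mulrNN mulr1 expr1n mul1r.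
Qed.

Lemma critical_point_gain (b : bool) (s : R[i]) : Phi z p s ->
  critical_point (gain b) s <-> critical_point RF s.
Proof.
move=> /Phi_horner_neq0[Ds Ns].
have RFs : RF s != 0 by rewrite /RF -!fpoly_horner mulf_neq0 ?invr_eq0.
split=> [H|]; last by rewrite gain_RF; exact: critical_point_inv.
rewrite (RF_gain b); apply: critical_point_inv H.
by rewrite gain_RF mulf_neq0 ?signr_eq0 ?invr_eq0.
Qed.

Lemma gain_sign (s : R[i]) : N \is a polyOver Num.real ->
    D \is a polyOver Num.real -> s \is Num.real ->
  exists b, (0 : R[i]) <= gain b s.
Proof.
move=> Nr Dr sr.
have : D.[s] / N.[s] \is Num.real by rewrite rpred_div// rpred_horner.
rewrite !fpoly_horner realE => /orP[g|g].
  by exists false; rewrite /gain expr0 mul1r.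
by exists true; rewrite /gain expr1 mulN1r oppr_ge0.
Qed.

(** * Root loci as branches of a pencil *)

(** The parameter [t] in []0, 1[] encodes the gain [t / (1 - t)]; the poles appear at [t = 0] and
    the zeros at [t = 1]. *)
Definition locus_poly (b : bool) (t : R) : {poly R[i]} :=
  (1 - t%:C) *: D - (t%:C * (-1) ^+ b) *: N.

Lemma sign2 (b : bool) : (-1) ^+ b * (-1) ^+ b = 1 :> R[i].
Proof. by rewrite -signr_addb addbb. Qed.

Lemma root_locus_poly (b : bool) (t : R) (x : R[i]) : 0 < t < 1 -> root (locus_poly b t) x ->
  [/\ D.[x] != 0, N.[x] != 0 & gain b x = (t / (1 - t))%:C].
Proof.
move=> /andP[t0 t1] /eqP; rewrite !hornerE => /eqP; rewrite subr_eq0 => /eqP E.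
have t0' : (t%:C : R[i]) != 0 by rewrite fmorph_eq0 gt_eqF.
have t1' : 1 - (t%:C : R[i]) != 0.
  by rewrite -(rmorph1 (real_complex R)) -rmorphB fmorph_eq0 subr_eq0 gt_eqF.
have Dx : D.[x] != 0.
  apply/eqP => Dx; have := coprimep_root fpoly_coprime (introT eqP Dx).
  move: E; rewrite Dx mulr0 => /esym/eqP.
  by rewrite !mulf_eq0 (negPf t0') signr_eq0 /= => ->.
have Nx : N.[x] != 0.
  apply/eqP => Nx; move: E; rewrite Nx mulr0 => /eqP.
  by rewrite mulf_eq0 (negPf t1') (negPf Dx).
split=> //; rewrite /gain -!fpoly_horner -/D -/N rmorphM fmorphV rmorphB rmorph1.
have -> : D.[x] = t%:C * (-1) ^+ b * N.[x] / (1 - t%:C) by rewrite -E; field.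
transitivity ((-1) ^+ b * (-1) ^+ b * (t%:C / (1 - t%:C))); last first.
  by rewrite sign2 mul1r.
by move: ((-1) ^+ b) => c; field; rewrite t1' Nx.
Qed.

Lemma locus_poly_root (b : bool) (x : R[i]) (g : R) : 0 < g -> D.[x] != 0 -> N.[x] != 0 ->
  gain b x = g%:C -> root (locus_poly b (g / (1 + g))) x.
Proof.
move=> g0 Dx Nx; rewrite /gain -!fpoly_horner -/D -/N => E.
have DE : D.[x] = g%:C * (-1) ^+ b * N.[x].
  rewrite -E -[LHS]mul1r -[X in X * _ = _](sign2 b).
  by move: ((-1) ^+ b) => c; field.
rewrite /root !hornerE DE.
have -> : 1 - (g / (1 + g)) %:C = ((1 + g)^-1)%:C :> R[i].
  rewrite -(rmorph1 (real_complex R)) -rmorphB; congr (_%:C).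
  by field; rewrite gt_eqF// addr_gt0.
by rewrite rmorphM; apply/eqP; ring.
Qed.

Lemma locus_poly0 (b : bool) (x : R[i]) :
  root (locus_poly b 0) x -> exists j, x = p j.
Proof.
rewrite /root /locus_poly rmorph0 mul0r scale0r !subr0 scale1r fpoly_horner.
by move=> /eqP/feval_eq0.
Qed.

Lemma locus_poly1 (b : bool) (x : R[i]) :
  root (locus_poly b 1) x -> exists l, x = z l.
Proof.
rewrite /root /locus_poly rmorph1 mul1r subrr scale0r sub0r !hornerE.
rewrite oppr_eq0 mulf_eq0 signr_eq0 /= fpoly_horner.
by move=> /eqP/feval_eq0.
Qed.

(** A zero of [y] is a passage through infinity. It occurs at most once, so cutting []0, 1[] there
    leaves an interval around [t0] on which the branch is finite. *)
Lemma interval_avoiding_zero (y : R -> R[i]) (t0 : R) :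
    0 < t0 < 1 -> y t0 != 0 ->
    (forall t u, 0 <= t <= 1 -> 0 <= u <= 1 -> y t = 0 -> y u = 0 -> t = u) ->
  exists a b, [/\ 0 <= a < t0, t0 < b <= 1, forall t, a < t < b -> y t != 0,
    a = 0 \/ y a = 0 & b = 1 \/ y b = 0].
Proof.
move=> /andP[t00 t01] yt0 yu.
have [[t1 [/andP[t10 t11] yt1]]|H] := pselect (exists t, 0 < t < 1 /\ y t = 0).
  have t1I : 0 <= t1 <= 1 by rewrite !ltW.
  have [t1t0|t0t1|t1t0] := ltgtP t1 t0.
  - exists t1, 1; split; rewrite ?t01 ?lexx ?ltW//=; [|by right|by left].
    move=> t /andP[t1t tlt1]; apply/eqP => yt; move: (t1t).
    by rewrite (yu t t1) ?ltxx// (ltW tlt1) (ltW (lt_trans t10 t1t)).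
  - exists 0, t1; split; rewrite ?t00 ?lexx ?t0t1 ?ltW//=; [|by left|by right].
    move=> t /andP[t0t tt1]; apply/eqP => yt; move: (tt1).
    by rewrite (yu t t1) ?ltxx// (ltW t0t) (ltW (lt_trans tt1 t11)).
  - by move: yt0; rewrite -t1t0 yt1 eqxx.
exists 0, 1; split; rewrite ?t00 ?t01 ?lexx//=; [|by left|by left].
by move=> t t01'; apply/eqP => yt; apply: H; exists t.
Qed.

(** The finite piece of the branch around [t0] is reparametrised affinely by []0, 1[]. Its gain
    increases with the parameter, and the limit of [y] at each end decides between infinity and a
    pole or zero. *)
Lemma root_locus_of_branch (b : bool) (w : R[i]) (y : R -> R[i]^o) (t0 : R) :
    continuous y ->
    (forall t u, 0 <= t <= 1 -> 0 <= u <= 1 -> y t = 0 -> y u = 0 -> t = u) ->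
    (forall t, 0 <= t <= 1 -> y t != 0 ->
      root (locus_poly b t) (w + (y t : R[i])^-1)) ->
    0 < t0 < 1 -> y t0 != 0 ->
  exists c, [/\ root_locus z gamma p beta b c, trace c (w + (y t0 : R[i])^-1)
    & forall x, trace c x -> exists t,
        [/\ 0 < t < 1, y t != 0 & x = w + (y t : R[i])^-1]].
Proof.
move=> yc yu yr t01 yt0.
have [al [om [/andP[al0 alt0] /andP[t0om om1] ynz alE omE]]] :=
  interval_avoiding_zero t01 yt0 yu.
have alom := lt_trans alt0 t0om.
have ao0 : 0 < om - al by rewrite subr_gt0.
pose phi (s : R) := al + (om - al) * s.
pose c (s : R) : R[i]^o := w + (y (phi s) : R[i])^-1.
have phi_in s : 0 < s < 1 -> al < phi s < om.
  move=> /andP[s0 s1]; rewrite ltrDl mulr_gt0//=.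
  by rewrite -ltrBrDl gtr_pMr.
have phi_in01 s : 0 < s < 1 -> 0 < phi s < 1.
  move=> /phi_in/andP[h1 h2].
  by rewrite (le_lt_trans al0 h1) (lt_le_trans h2 om1).
have ynz' s : 0 < s < 1 -> y (phi s) != 0 by move=> /phi_in; exact: ynz.
have cr s : 0 < s < 1 -> root (locus_poly b (phi s)) (c s).
  move=> s01; apply: yr; last exact: ynz'.
  by have /andP[h1 h2] := phi_in01 s s01; rewrite !ltW.
have gE s : 0 < s < 1 -> gain b (c s) = (phi s / (1 - phi s))%:C.
  by move=> s01; have [] := root_locus_poly (phi_in01 s s01) (cr s s01).
have phic : continuous phi.
  move=> s; apply: cvgD; first exact: cvg_cst.
  by apply: cvgM; [exact: cvg_cst | exact: cvg_id].
have yphic : continuous (fun s => y (phi s)).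
  by move=> s; apply: (@continuous_comp _ _ _ phi y); [exact: phic | exact: yc].
have cvg_c s (F : set_system R) (FF : Filter F) :
    y (phi t) @[t --> F] --> y (phi s) -> y (phi s) != 0 ->
    c t @[t --> F] --> (w + (y (phi s) : R[i])^-1 : R[i]^o).
  by move=> ys ys0; apply: cvgD; [exact: cvg_cst | exact: cvgV].
exists c; split.
- split.
  + move=> s; rewrite in_itv /= => s01.
    by apply: (cvg_c s _ (nbhs_filter s)); [exact: yphic | exact: ynz'].
  + move=> s; rewrite in_itv /= => s01.
    have [Dx Nx _] := root_locus_poly (phi_in01 s s01) (cr s s01).
    split.
      have /andP[h1 h2] := phi_in01 s s01.
      by rewrite gE// lecR divr_ge0 ?subr_ge0 ?ltW.
    by rewrite gain_RF mulfVK// /Defs.RF -!fpoly_horner mulf_neq0 ?invr_eq0.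
  + move=> s u; rewrite !in_itv /= => s01 u01 su.
    have /andP[s0 s1] := phi_in01 s s01; have /andP[u0 u1] := phi_in01 u u01.
    rewrite !gE// ltcR ltr_pdivrMr ?subr_gt0// mulrAC ltr_pdivlMr ?subr_gt0//.
    rewrite !mulrBr !mulr1 [X in _ < _ - X]mulrC ltrD2r.
    by rewrite ltrD2l ltr_pM2l.
  + have phi0 : phi 0 = al by rewrite /phi mulr0 addr0.
    have y0 : y (phi s) @[s --> 0^'+] --> y (phi 0).
      exact: cvg_at_right_filter (yphic 0).
    have yn0 : \forall s \near 0^'+, y (phi s) != 0.
      rewrite near_withinE; apply: filterS (lt_nbhsl (@ltr01 R)) => s s1 s0.
      by apply: ynz'; rewrite s0.
    (* The value of [y] is tested first, since a branch may start at infinity even when [al = 0]. *)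
    have [yal|yal] := eqVneq (y al) 0.
      right; apply: tends_to_infinity_addV yn0.
      by rewrite -yal -phi0.
    left; case: alE => [al_0|]; last by move/eqP; rewrite (negPf yal).
    have [|j Ej] := @locus_poly0 b (w + (y 0 : R[i])^-1).
      by apply: yr; rewrite ?lexx ?ler01// -al_0.
    exists j; rewrite -Ej -[X in y X]al_0 -phi0.
    by apply: (cvg_c 0 _ _ y0); rewrite phi0.
  + have phi1 : phi 1 = om by rewrite /phi mulr1 addrC subrK.
    have y1 : y (phi s) @[s --> 1^'-] --> y (phi 1).
      exact: cvg_at_left_filter (yphic 1).
    have yn1 : \forall s \near 1^'-, y (phi s) != 0.
      rewrite near_withinE; apply: filterS (lt_nbhsr (@ltr01 R)) => s s0 s1.
      by apply: ynz'; rewrite s0.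
    have [yom|yom] := eqVneq (y om) 0.
      right; apply: tends_to_infinity_addV yn1.
      by rewrite -yom -phi1.
    left; case: omE => [om_1|]; last by move/eqP; rewrite (negPf yom).
    have [|l El] := @locus_poly1 b (w + (y 1 : R[i])^-1).
      by apply: yr; rewrite ?lexx ?ler01// -om_1.
    exists l; rewrite -El -[X in y X]om_1 -phi1.
    by apply: (cvg_c 1 _ _ y1); rewrite phi1.
- exists ((t0 - al) / (om - al)).
    rewrite /= in_itv /= divr_gt0 ?subr_gt0//= ltr_pdivrMr// mul1r.
    by rewrite ltrD2r.
  by rewrite /c (_ : phi _ = t0)// /phi; field; rewrite gt_eqF.
- move=> _ [s + <-]; rewrite /= in_itv /= => s01.
  by exists (phi s); split; [exact: phi_in01 | exact: ynz' | ].
Qed.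
Lemma locus_polyE (b : bool) (t : R) :
  locus_poly b t = (1 - t%:C) *: D + (- (t%:C * (-1) ^+ b)) *: N.
Proof. by rewrite scaleNr. Qed.

(** * From critical points to breakaway points *)

Lemma critical_breakaway (b : bool) (s : R[i]) : Phi z p s ->
    0 <= (gain b s : R[i]) -> (wronskian D N).[s] = 0 ->
  breakaway_point z gamma p beta s.
Proof.
move=> /Phi_horner_neq0[Ds Ns] gs0 Ws.
have [g g0 Eg] : exists2 g : R, 0 < g & gain b s = g%:C.
  have Eg : gain b s = (complex.Re (gain b s))%:C by rewrite RRe_real// ger0_real.
  exists (complex.Re (gain b s)) => //.
  rewrite -ltcR -Eg lt_neqAle gs0 andbT eq_sym /gain -!fpoly_horner.
  by rewrite mulf_neq0 ?signr_eq0// mulf_neq0// invr_eq0.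
(* The solution of [t / (1 - t) = g]. *)
pose t0 := g / (1 + g).
have g1 : 0 < 1 + g by rewrite addr_gt0.
have t01 : 0 < t0 < 1 by rewrite divr_gt0//= ltr_pdivrMr// mul1r ltrDr.
have t01' : 0 <= t0 <= 1 by have /andP[? ?] := t01; rewrite !ltW.
have rs : root (locus_poly b t0) s := locus_poly_root g0 Ds Ns Eg.
have r's : root (locus_poly b t0)^`() s.
  move: rs; rewrite /root locus_polyE => /eqP rs; apply/eqP.
  exact: root_deriv_wronskian Ds Ws rs.
(* The number of roots on the projective line, those at infinity included. *)
pose d := (maxn (size D) (size N)).-1.
have Ed : maxn (size D) (size N) = d.+1.
  by rewrite /d prednK// leq_max size_poly_gt0 (monic_neq0 (fpoly_monic _ _)).
have d0 : (0 < d)%N.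
  rewrite -ltnS -Ed leq_max; move: mn_gt0; rewrite addn_gt0.
  by case/orP => k0; apply/orP; [right|left]; exact: size_fpoly_gt1.
have e2 : ((-1) ^+ b) ^+ 2 = 1 :> R[i] by rewrite expr2 sign2.
have [w [y [yc yu yp]]] := projective_selection (@real_complex_continuous R)
  e2 d0 Ed (fpoly_monic p beta) (fpoly_monic z gamma) fpoly_coprime.
have yr i t : 0 <= t <= 1 -> y i t != 0 ->
    root (locus_poly b t) (w + (y i t : R[i])^-1).
  move=> /yp[l l0 El] yit; rewrite /root /locus_poly El hornerZ horner_prod.
  have F0 : (1 - (y i t : R[i])%:P * ('X - w%:P)).[w + (y i t : R[i])^-1] = 0.
    by rewrite !hornerE addrAC subrr add0r divff// subrr.
  by rewrite (bigD1 i)//= F0 mul0r mulr0.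
have [l l0 El] := yp t0 t01'.
have [i [j [ij yi yj]]] : exists i j : 'I_d,
    [/\ i != j, (y i t0 : R[i]) * (s - w) = 1 & (y j t0 : R[i]) * (s - w) = 1].
  exact: (moebius_prod_double_root l0 El rs r's).
have sw : s - w != 0.
  by apply/eqP => sw; move: yi; rewrite sw mulr0 => /esym/eqP; rewrite oner_eq0.
have Ey k : (y k t0 : R[i]) * (s - w) = 1 ->
    y k t0 != 0 /\ w + (y k t0 : R[i])^-1 = s.
  move=> E; have -> : (y k t0 : R[i]) = (s - w)^-1.
    by apply: (mulIf sw); rewrite E mulVf.
  by split; [rewrite invr_eq0 | rewrite invrK addrCA subrr addr0].
have [yi0 Ei] := Ey i yi; have [yj0 Ej] := Ey j yj.
have [c1 [L1 T1 C1]] := root_locus_of_branch (yc i) (yu i) (yr i) t01 yi0.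
have [c2 [L2 T2 C2]] := root_locus_of_branch (yc j) (yu j) (yr j) t01 yj0.
exists b, b, c1, c2; split=> //; split; [by rewrite -Ei|by rewrite -Ej|].
(* Roots of the Wronskian are isolated, so it suffices that every common point of the two loci is
   one of them. *)
apply: filterS (isolated_root s fpoly_wronskian_neq0) => x Hx.
move=> /C1[t [tI yit xE]] /C2[u [uI yju xE']].
apply: Hx.
have tI' : 0 <= t <= 1 by have /andP[? ?] := tI; rewrite !ltW.
have uI' : 0 <= u <= 1 by have /andP[? ?] := uI; rewrite !ltW.
have rt : root (locus_poly b t) x by rewrite xE; exact: yr.
have ru : root (locus_poly b u) x by rewrite xE'; exact: yr.
have [_ _ gt_] := root_locus_poly tI rt.
have [_ _ gu] := root_locus_poly uI ru.
(* The gain at [x] determines the parameter, so the two branches meet at the same [t] and make [x] a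
   double root of the pencil. *)
have tu : t = u.
  move: gu; rewrite gt_ => /complexI.
  have /andP[t0_ t1] := tI; have /andP[u0 u1] := uI.
  have nt1 : 1 - t != 0 by rewrite subr_eq0 gt_eqF.
  have nu1 : 1 - u != 0 by rewrite subr_eq0 gt_eqF.
  by move/eqP; rewrite eqr_div// => /eqP; lra.
have yij : (y i t : R[i]) = y j t.
  by apply: invr_inj; apply: (addrI w); rewrite -xE tu -xE'.
have [l' l'0 El'] := yp t tI'.
have t1n : 1 - (t%:C : R[i]) != 0.
  have /andP[_ t1] := tI.
  by rewrite -(rmorph1 (real_complex R)) -rmorphB fmorph_eq0 subr_eq0 gt_eqF.
apply: (mulfI t1n); rewrite mulr0.
apply: (@wronskian_root _ _ _ _ (- (t%:C * (-1) ^+ b))); rewrite -locus_polyE.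
  exact/eqP.
rewrite /locus_poly El' derivZ hornerZ (@deriv_prod_double_root _ _ _ i j) ?mulr0//.
  by rewrite !hornerE xE addrAC subrr add0r divff// subrr.
by rewrite !hornerE xE addrAC subrr add0r -yij divff// subrr.
Qed.

(** * From breakaway points to critical points *)

Lemma gain_neq0 (b : bool) (x : R[i]) : root_locus_point z gamma p beta b x ->
  gain b x != 0.
Proof.
move=> [_ E]; apply/eqP => g0; move: E; rewrite g0 mul0r => /esym/eqP.
by rewrite signr_eq0.
Qed.

Lemma root_locus_point_horner (b : bool) (x : R[i]) :
  root_locus_point z gamma p beta b x -> D.[x] != 0 /\ N.[x] != 0.
Proof.
move=> /gain_neq0; rewrite /gain -!fpoly_horner mulf_eq0 signr_eq0 /=.
by rewrite mulf_eq0 invr_eq0 negb_or => /andP.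
Qed.

Lemma gain_continuous_at (b : bool) (x : R[i]^o) : N.[x] != 0 ->
  {for x, continuous (gain b)}.
Proof.
move=> Nx; have -> : gain b = fun u : R[i]^o => (-1) ^+ b * (D.[u] / N.[u]).
  by apply/funext => u; rewrite /gain !fpoly_horner.
have FF := nbhs_filter x.
have Nc := @cvgV _ _ (nbhs x) FF _ _ Nx (@horner_continuous _ N x).
have DNc := @cvgM _ _ (nbhs x) FF _ _ _ _ (@horner_continuous _ D x) Nc.
exact: (@cvgM _ _ (nbhs x) FF _ _ _ _ (cvg_cst _) DNc).
Qed.

Lemma gain_eq_ratio (b : bool) (x y : R[i]) : N.[x] != 0 -> N.[y] != 0 ->
  gain b x = gain b y -> N.[x] * D.[y] = N.[y] * D.[x].
Proof.
move=> Nx Ny; rewrite /gain -!fpoly_horner => /(mulfI _) E.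
have /eqP : D.[x] / N.[x] = D.[y] / N.[y] by apply: E; rewrite signr_eq0.
by rewrite eqr_div// => /eqP; rewrite mulrC [_ * N.[x]]mulrC => ->.
Qed.

(** Otherwise, by the intermediate value theorem, [c2] takes the gain of [c1 u1] at some [v], and
    injectivity on [V] gives [c2 v = c1 u1]. This common point must be [s], yet its gain exceeds
    that of [s]. *)
Lemma root_loci_disjoint_after (b : bool) (c1 c2 : R -> R[i]^o) (s : R[i]^o)
    (V : set R[i]^o) (t1 u1 t2 u2 : R) :
    root_locus z gamma p beta b c1 -> root_locus z gamma p beta b c2 ->
    (forall x y, V x -> V y -> N.[x] * D.[y] = N.[y] * D.[x] -> x = y) ->
    (forall x, V x -> trace c1 x -> trace c2 x -> x = s) ->
    0 < t1 < u1 -> u1 < 1 -> 0 < t2 < u2 -> u2 < 1 ->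
    c1 t1 = s -> c2 t2 = s -> V (c1 u1) ->
    (forall v, t2 <= v <= u2 -> V (c2 v)) ->
  complex.Re (gain b (c2 u2)) < complex.Re (gain b (c1 u1)).
Proof.
move=> [_ p1 i1 _ _] [k2 p2 i2 _ _] Vinj Vs /andP[t10 tu1] u11 /andP[t20 tu2] u21.
move=> c1t c2t V1 V2.
have Ereal (x : R[i]) : root_locus_point z gamma p beta b x ->
    gain b x = (complex.Re (gain b x))%:C.
  by move=> [g _]; rewrite RRe_real// ger0_real.
have t1I : t1 \in `]0, 1[ by rewrite in_itv /= t10 (lt_trans tu1).
have u1I : u1 \in `]0, 1[ by rewrite in_itv /= u11 (lt_trans t10).
have vI v : t2 <= v <= u2 -> v \in `]0, 1[.
  by move=> /andP[tv vu]; rewrite in_itv /= (lt_le_trans t20 tv) (le_lt_trans vu).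
have g1 : complex.Re (gain b s) < complex.Re (gain b (c1 u1)).
  have := i1 _ _ t1I u1I tu1; rewrite (Ereal _ (p1 _ u1I)) (Ereal _ (p1 _ t1I)).
  by rewrite c1t ltcR.
rewrite ltNge; apply/negP => g2.
pose f v := complex.Re (gain b (c2 v)).
have fc : {within `[t2, u2], continuous f}.
  apply: continuous_in_subspaceT => v; rewrite inE /= in_itv /= => vtu.
  have vv := vI v vtu; have [_ Nv] := root_locus_point_horner (p2 v vv).
  apply: (@continuous_comp _ _ _ (fun v => gain b (c2 v)) (fun x => complex.Re x)).
    apply: (@continuous_comp _ _ _ c2 (gain b)); first exact: k2.
    exact: gain_continuous_at.
  exact: Re_continuous.
have [|v vtu fv] := IVT (ltW tu2) fc (v := complex.Re (gain b (c1 u1))).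
  rewrite ge_min le_max g2 orbT andbT /f c2t.
  by rewrite (ltW g1).
move: vtu; rewrite in_itv /= => vtu.
have vv := vI v vtu.
have E : c1 u1 = c2 v.
  apply: Vinj => //; first exact: V2.
  have [_ N1] := root_locus_point_horner (p1 _ u1I).
  have [_ N2] := root_locus_point_horner (p2 _ vv).
  apply: (@gain_eq_ratio b) => //.
  by rewrite (Ereal _ (p1 _ u1I)) (Ereal _ (p2 _ vv)) -fv.
have cs : c1 u1 = s.
  by apply: Vs => //; [exists u1 | rewrite E; exists v].
by move: g1; rewrite cs ltxx.
Qed.

Lemma breakaway_critical (s : R[i]) : Phi z p s ->
  breakaway_point z gamma p beta s -> (wronskian D N).[s] = 0.
Proof.
move=> /Phi_horner_neq0[Ds Ns] [b1 [b2 [c1 [c2 [L1 L2 [[t1 t1I c1s] [t2 t2I c2s] near_s]]]]]].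
apply/eqP/negPn/negP => Ws.
have [_ p1 _ _ _] := L1; have [_ p2 _ _ _] := L2.
have r1 : root_locus_point z gamma p beta b1 s by rewrite -c1s; exact: p1.
have r2 : root_locus_point z gamma p beta b2 s by rewrite -c2s; exact: p2.
(* For different signs the gains at [s] are opposite, both nonnegative and nonzero, which is
   impossible. *)
have b12 : b1 = b2.
  apply/eqP/negPn/negP => b12.
  have Eb : gain b2 s = - gain b1 s.
    rewrite /gain; move: b12; case: (b1); case: (b2) => //= _.
      by rewrite expr0 expr1 mulN1r opprK mul1r.
    by rewrite expr0 expr1 mulN1r mul1r.
  have [g1 _] := r1; have [g2 _] := r2; have := gain_neq0 r1.
  by rewrite eq_le g1 andbT -oppr_ge0 -Eb g2.
subst b2; set b := b1 in L1 L2 p1 p2 r1 r2.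
have [V0 nV0 Vinj] := ratio_locally_injective Ws.
pose V : set R[i]^o := V0 `&` [set x | trace c1 x -> trace c2 x -> x = s].
have nV : nbhs (s : R[i]^o) V by exact: filterI.
have after c t : root_locus z gamma p beta b c -> t \in `]0, 1[ -> c t = s ->
    exists u, [/\ 0 < t < u, u < 1 & forall v, t <= v <= u -> V (c v)].
  move=> [cc _ _ _ _] tI cts; move: (tI); rewrite in_itv /= => /andP[t_gt0 t_lt1].
  have : \forall v \near t, V (c v) by apply: (cc t tI); rewrite cts.
  move=> /nbhs_ballP[r r0 Hr].
  (* Late enough to lie after [t], early enough to stay below 1 and keep the locus inside [V]. *)
  pose u := Num.min ((t + 1) / 2) (t + r / 2).
  exists u; split.
  - by rewrite t_gt0 lt_min midf_lt//= ltrDl divr_gt0.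
  - by rewrite gt_min midf_lt.
  - move=> v /andP[tv]; rewrite le_min => /andP[_ vr]; apply: Hr.
    rewrite /ball /= ltr_distlC (lt_le_trans _ tv) ?ltrBlDr ?ltrDl//=.
    by rewrite (le_lt_trans vr)// ltrD2l ltr_pdivrMr// ltr_pMr// ltr1n.
have [u1 [tu1 u11 V1]] := after c1 t1 L1 t1I c1s.
have [u2 [tu2 u21 V2]] := after c2 t2 L2 t2I c2s.
have Vinj' x y : V x -> V y -> N.[x] * D.[y] = N.[y] * D.[x] -> x = y.
  by move=> [Vx _] [Vy _]; exact: Vinj.
have l1 : t1 <= u1 <= u1 by have /andP[_ /ltW ->] := tu1; rewrite lexx.
have l2 : t2 <= u2 <= u2 by have /andP[_ /ltW ->] := tu2; rewrite lexx.
(* Exchanging the two loci yields the opposite strict inequality between the same two gains. *)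
have g12 := root_loci_disjoint_after L1 L2 Vinj' (fun x Vx => Vx.2)
  tu1 u11 tu2 u21 c1s c2s (V1 u1 l1) V2.
have g21 := root_loci_disjoint_after L2 L1 Vinj'
  (fun x Vx h2 h1 => Vx.2 h1 h2) tu2 u21 tu1 u11 c2s c1s (V2 u2 l2) V1.
by have := lt_trans g12 g21; rewrite ltxx.
Qed.

End Loci.

(** * Comparison of the three sets of points *)

Theorem theorem2p23 (R : realType) (m n : nat)
    (z : 'I_m -> R[i]) (gamma : 'I_m -> nat)
    (p : 'I_n -> R[i]) (beta : 'I_n -> nat)
    (gamma_gt0 : forall l, (0 < gamma l)%N)
    (beta_gt0 : forall j, (0 < beta j)%N)
    (z_inj : injective z) (p_inj : injective p)
    (z_neq_p : forall l j, z l <> p j)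
    (RF_nonconstant : (0 < m + n)%N)
    (num_real : fpoly z gamma \is a polyOver Num.real)
    (den_real : fpoly p beta \is a polyOver Num.real)
    (s : R[i]) (s_Phi : Phi z p s) :
  [/\ Omega_c z gamma p beta s -> Omega_K z gamma p beta s,
      Omega_K z gamma p beta s -> Omega_c z gamma p beta s
    & Omega_b z gamma p beta s <->
      Omega_c z gamma p beta s /\ Omega_K z gamma p beta s].
Proof.
have [Ds Ns] := Phi_horner_neq0 gamma beta s_Phi.
have critRF : critical_point (RF z gamma p beta) s <->
    (wronskian (fpoly p beta) (fpoly z gamma)).[s] = 0.
  exact: critical_point_RF.
have cK : Omega_c z gamma p beta s -> Omega_K z gamma p beta s.
  move=> [sr sc mz mp]; split=> //.
  (* Real coefficients make the gain real at a real point, so one of the two signs makes it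
     nonnegative. *)
  have [b gb] := gain_sign num_real den_real sr.
  by exists b; split=> //; apply/critical_point_gain.
split=> //.
  move=> [sr [b [_ sc]] mz mp]; split=> //.
  by move: sc => /critical_point_gain; exact.
split=> [[sr sb mz mp]|[[sr sc mz mp] [_ [b [gb _]] _ _]]].
  have sO : Omega_c z gamma p beta s.
    by split=> //; apply/critRF; exact: breakaway_critical sb.
  by split=> //; exact: cK.
split=> //; apply: (critical_breakaway _ _ _ _ s_Phi gb) => //.
exact/critRF.
Qed.
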